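(* Let $N\ge 1$ be an integer, let $\mu,\sigma,\tau>0$, let $\mathbb{X}=L^2(\mathbb{R}^N)$ with norm $\|\cdot\|$, let $\mathcal{C}=C([-\tau,0];\mathbb{X})$ with the supremum norm, let $g\in\mathbb{X}$, and let $f$ satisfy $f(0)=0$ and $\|f(\phi_1)-f(\phi_2)\|\le L_f\|\phi_1-\phi_2\|_{\mathcal{C}}$ for all $\phi_1,\phi_2\in\mathcal{C}$. Assume that $\sigma(L_f+1)e^{\mu\tau}-\mu<0$, and let $\mathcal{A}\subset\mathcal{C}$ be the global attractor of the dynamical system $\Phi$ on $\mathcal{C}$ generated by $$\frac{\partial u}{\partial t}(x,t)=\Delta u(x,t)-\mu u(x,t)+\sigma u(x,t-\tau)+f(u(x,t-\tau))+g(x),\quad t>0,\ x\in\mathbb{R}^N,$$ $$u(x,s)=\phi(x,s),\quad -\tau\le s\le 0,\ x\in\mathbb{R}^N.$$ Let $c_2=e^{(\mu-\sigma-1)\tau}$, and let $m\ge1$, $k_m$, $\varrho_1$, $\varrho_m<0$ and $K_m$ be the spectral quantities, described in the context, of the linear delayed Dirichlet problem on the ball $\Omega_K$. Suppose that there exists $\beta>0$ such that $$\zeta:=\beta e^{L_f+\varrho_1}+K_me^{\varrho_m}+\frac{K_mL_f}{\varrho_1+L_f-\varrho_m}e^{L_f+\varrho_1}+\sqrt{c_2}\,e^{\frac{c_2(\sigma+L_f^2)-(\mu-\sigma-1)}{2}}<1.$$ Then the fractal dimension of $\mathcal{A}$ satisfies $$\dim_f\mathcal{A}\le\frac{\ln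 k_m+k_m\ln\left(2+\frac2\beta\right)}{-\ln\zeta}<\infty.$$
   Context: $\|\phi\|_{\mathcal{C}}=\sup_{\theta\in[-\tau,0]}\|\phi(\theta)\|$, and $u_t(\theta)=u(t+\theta)$ for $\theta\in[-\tau,0]$. The nonlinearity is a map $f:\mathbb{X}\to\mathbb{X}$ acting on the delayed state $u(\cdot,t-\tau)$; it is regarded as an operator on $\mathcal{C}$ by writing $f(\phi)$ for $f(\phi(-\tau))$. Solutions are mild: with $S(t)$ the $C_0$-semigroup on $\mathbb{X}$ generated by $\Delta-\mu I$, $$u(t)=S(t)\phi(0)+\sigma\int_0^tS(t-s)u(s-\tau)\,ds+\int_0^tS(t-s)[f(u(s-\tau))+g]\,ds,\quad t>0,\qquad u_0=\phi.$$ Each $\phi\in\mathcal{C}$ has a unique solution $u^\phi\in C([-\tau,\infty);\mathbb{X})$, and $\Phi(t,\phi)=u^\phi_t$. The global attractor is the compact set $\mathcal{A}\subset\mathcal{C}$ with $\Phi(t,\mathcal{A})=\mathcal{A}$ for all $t\ge0$ that attracts every bounded subset of $\mathcal{C}$ in the Hausdorff semidistance. Choice of $K$: fix $\varepsilon>0$ and a bounded set $\mathcal{D}\subset\mathcal{C}$, and let $T(\varepsilon),R(\varepsilon)>0$ be such that $\sup_{\theta\in[-\tau,0]}\int_{|x|\ge K'}|u^\phi(x,t+\theta)|^2dx\le\varepsilon$ for all $\phi\in\mathcal{D}$, $t\ge T(\varepsilon)$ and $K'\ge R(\varepsilon)$. Put $K=R(\varepsilon)$ and $\Omega_K=\{x\in\mathbb{R}^N:|x|<K\}$.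 Spectral quantities: let $\mathcal{C}_{\Omega_K}=C([-\tau,0];L^2(\Omega_K))$ with the supremum norm, and let $U(t)$, $t\ge0$, be the linear solution semigroup $U(t)\varphi=\tilde v_t^{\varphi}$ on $\mathcal{C}_{\Omega_K}$ of $$\partial_t\tilde v(x,t)=\Delta\tilde v(x,t)-\mu\tilde v(x,t)+\sigma\tilde v(x,t-\tau)\ \text{ in }\Omega_K,\qquad \tilde v=0\ \text{ on }\partial\Omega_K,\qquad \tilde v_0=\varphi.$$ Let $A_U$ be its infinitesimal generator. The spectrum of $A_U$ consists of eigenvalues; denote by $\varrho_1>\varrho_2>\cdots$ the distinct values of their real parts and by $n_j$ the total (algebraic) multiplicity of the eigenvalues with real part $\varrho_j$. In particular $\varrho_1$ is the maximal real part of the eigenvalues of $A_U$. Fix $m\ge1$ with $\varrho_m<0$ and put $k_m=n_1+\cdots+n_m$. Let $P_{k_m}$ be the spectral projection of $\mathcal{C}_{\Omega_K}$ onto the $k_m$-dimensional generalized eigenspace associated with the eigenvalues of real part $\varrho_1,\dots,\varrho_m$, and $Q_{k_m}=I-P_{k_m}$. $K_m>0$ is a constant such that $\|U(t)Q_{k_m}x\|\le K_me^{\varrho_mt}\|x\|$ for all $t\ge0$, $x\in\mathcal{C}_{\Omega_K}$. Fractal dimension: $\dim_f\mathcal{A}=\limsup_{\varepsilon\to0}\frac{\ln N_\varepsilon(\mathcal{A})}{-\ln\varepsilon}$, where $N_\varepsilon(\mathcal{A})$ is the minimum number of balls of $\mathcal{C}$ of radius less than $\varepsilon$ needed to cover $\mathcal{A}$.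 *)

(* Defs.v *)
From HB Require Import structures.
From mathcomp Require Import all_boot all_order all_algebra.
From mathcomp Require Import all_classical all_reals all_analysis.
From mathcomp Require Import measurable_realfun complex.
Set Implicit Arguments.
Unset Strict Implicit.
Unset Printing Implicit Defensive.
Import Order.TTheory GRing.Theory Num.Theory.
Import numFieldNormedType.Exports.
Local Open Scope classical_set_scope.
Local Open Scope ring_scope.
Local Open Scope quotient_scope.

Section L2.
Context d (T : measurableType d) (R : realType) (mu : {measure set T -> \bar R}).
Local Notation Lf := (LfunType mu (lee1n 2)).

Definition ae_null : {pred Lf} := fun f => `[< {ae mu, forall x, f x = 0} >].

Fact ae_null_zmod_closed : zmod_closed ae_null.
Proof.
split; first by apply/asboolP/nearW.
move=> f g /asboolP f0 /asboolP g0; apply/asboolP.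
apply: filterS2 f0 g0 => x f0 g0.
by rewrite -[LHS]/(f x - g x) f0 g0 subrr.
Qed.

HB.instance Definition _ := GRing.isZmodClosed.Build Lf ae_null
  ae_null_zmod_closed.

(* Square-integrable functions up to almost everywhere equality. *)
Definition L2 : Type := {ideal_quot [the zmodClosed Lf of ae_null]}.
HB.instance Definition _ := GRing.Zmodule.on L2.
HB.instance Definition _ := EqQuotient.on L2.
HB.instance Definition _ := ZmodQuotient.on L2.

Definition L2_fun (f : L2) : T -> R := repr f.
Coercion L2_fun : L2 >-> Funclass.

Lemma L2_piP (f g : Lf) :
  {ae mu, forall x, f x = g x} <-> \pi_L2 f = \pi_L2 g.
Proof.
split=> [fg|/eqP].
  apply/eqP; rewrite -Quotient.idealrBE; apply/asboolP.
  by apply: filterS fg => x fgx; rewrite -[LHS]/(f x - g x) fgx subrr.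
rewrite -Quotient.idealrBE => /asboolP.
apply: filterS => x; rewrite -[X in X = _]/(f x - g x) => /eqP.
by rewrite subr_eq0 => /eqP.
Qed.

Lemma L2_piE (f : Lf) : {ae mu, forall x, (\pi_L2 f : L2) x = f x}.
Proof. by apply/L2_piP; rewrite reprK. Qed.

Lemma L2_pi_surj (f : L2) : exists g : Lf, f = \pi_L2 g.
Proof. by exists (repr f); rewrite reprK. Qed.

Definition L2_scale (a : R) (f : L2) : L2 := \pi_L2 (a *: repr f).

Lemma L2_pi_scale a (f : Lf) : L2_scale a (\pi_L2 f) = \pi_L2 (a *: f).
Proof.
apply/L2_piP; have := L2_piE f; apply: filterS => x fx.
by rewrite -[RHS]/(a * f x) -fx.
Qed.

Fact L2_scaleA a b (f : L2) : L2_scale a (L2_scale b f) = L2_scale (a * b) f.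
Proof. by have [g ->] := L2_pi_surj f; rewrite !L2_pi_scale scalerA. Qed.

Fact L2_scale1 : left_id 1 L2_scale.
Proof. by move=> f; have [g ->] := L2_pi_surj f; rewrite L2_pi_scale scale1r. Qed.

Fact L2_scaleDr : right_distributive L2_scale +%R.
Proof.
move=> a f g; have [f' ->] := L2_pi_surj f; have [g' ->] := L2_pi_surj g.
by rewrite -raddfD !L2_pi_scale -raddfD scalerDr.
Qed.

Fact L2_scaleDl f : {morph L2_scale^~ f : a b / a + b}.
Proof.
by move=> a b; have [g ->] := L2_pi_surj f; rewrite !L2_pi_scale -raddfD scalerDl.
Qed.

HB.instance Definition _ := GRing.Zmodule_isLmodule.Build R L2
  L2_scaleA L2_scale1 L2_scaleDr L2_scaleDl.

Definition L2_norm (f : L2) : R := fine 'N[mu]_2%:R%:E[EFin \o f].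

Fact ae_eq_Lnorm2 (f g : Lf) : {ae mu, forall x, f x = g x} ->
  ('N[mu]_2%:R%:E[EFin \o f] = 'N[mu]_2%:R%:E[EFin \o g])%E.
Proof.
move=> fg; rewrite unlock; congr (_ `^ _)%E.
have H (h : Lf) : measurable_fun setT (fun x => `|(EFin \o h) x| `^ 2)%E.
  apply: (measurableT_comp (measurable_poweR _)) => //.
  apply: measurableT_comp => //; exact/measurable_EFinP.
apply: ge0_ae_eq_integral => //.
- by move=> x _; exact: poweR_ge0.
- by move=> x _; exact: poweR_ge0.
- by apply: filterS fg => x /= ->.
Qed.

Lemma L2_norm_pi (f : Lf) : L2_norm (\pi_L2 f) = fine 'N[mu]_2%:R%:E[EFin \o f].
Proof. by congr fine; apply: ae_eq_Lnorm2; exact: L2_piE. Qed.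

Fact L2_ler_normD f g : L2_norm (f + g) <= L2_norm f + L2_norm g.
Proof.
have [f' ->] := L2_pi_surj f; have [g' ->] := L2_pi_surj g.
rewrite -raddfD !L2_norm_pi.
exact: ler_LnormD.
Qed.

Fact L2_normrZ a f : L2_norm (a *: f) = `|a| * L2_norm f.
Proof.
have [g ->] := L2_pi_surj f; rewrite [a *: _]L2_pi_scale !L2_norm_pi.
rewrite (_ : EFin \o _ = EFin \o (a \*: g))// LnormZ.
by rewrite -finite_norm_fine.
Qed.

Fact L2_normr0_eq0 f : L2_norm f = 0 -> f = 0.
Proof.
move=> /fine_Lnormr_eq0 f0.
rewrite -(reprK f) -(raddf0 \pi_L2); apply/L2_piP.
by apply: filterS f0 => x; exact.
Qed.

HB.instance Definition _ := Lmodule_isNormed.Build R L2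
  L2_ler_normD L2_normrZ L2_normr0_eq0.
End L2.

Section Rn.
Context (R : realType) (N : nat).

Definition Rn : Type := 'rV[R]_N.
HB.instance Definition _ := NormedModule.on Rn.

Definition xcoord (i : 'I_N) (x : Rn) : R := x ord0 i.

(* The sigma-algebra generated by the coordinates, i.e. the Borel sets. *)
HB.instance Definition _ := @isMeasurable.Build
  (measure_tuple_display default_measure_display) Rn (g_sigma_preimage xcoord)
  (@sigma_algebra0 _ _ _) (@sigma_algebraC _ _) (@sigma_algebra_bigcup _ _ _).

(* The norm `|x| of 'rV[R]_N is the sup norm, hence this Euclidean norm. *)
Definition enorm (x : Rn) : R := Num.sqrt (\sum_i (xcoord i x) ^+ 2).

Definition eball (K : R) : set Rn := [set x | enorm x < K].

Lemma measurable_xcoord i : measurable_fun [set: Rn] (xcoord i).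
Proof.
move=> _ Y mY; rewrite setTI; apply: sub_sigma_algebra => /=.
rewrite -bigcup_seq/=; exists i => /=; first by rewrite mem_index_enum.
by exists Y => //; rewrite setTI.
Qed.

Lemma measurable_to_Rn d (T : measurableType d) (f : T -> Rn) :
  (forall i, measurable_fun setT (xcoord i \o f)) -> measurable_fun setT f.
Proof.
move=> mf; apply: (@measurability _ _ _ _ _ _ (\big[setU/set0]_(i < N)
  preimage_set_system setT (xcoord i) measurable)) => // _ [B + <-].
rewrite -bigcup_seq => -[i _ [Y mY <-]].
rewrite !setTI -comp_preimage -[X in measurable X]setTI; exact: mf.
Qed.

Lemma measurable_enorm : measurable_fun [set: Rn] enorm.
Proof.
apply: (@measurableT_comp _ _ _ _ _ _ (@Num.sqrt R)).
  apply: continuous_measurable_fun; exact: sqrt_continuous.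
apply: (measurable_sum _ (h := fun i x => xcoord i x ^+ 2)) => i.
by apply: measurable_funX; exact: measurable_xcoord.
Qed.

Lemma measurable_eball K : measurable (eball K).
Proof.
rewrite -[eball K]setTI.
have := measurable_enorm measurableT (measurable_itv `]-oo, K[).
by congr (measurable (_ `&` _)); apply/seteqP; split=> x /=; rewrite in_itv.
Qed.

End Rn.
Arguments eball {R} N K.

Section lebesgue_Rn.
Context (R : realType).

Definition row_cons N (p : Rn R N * R) : Rn R N.+1 :=
  row_mx (p.2%:M : 'rV[R]_1) p.1.

Lemma measurable_row_cons N : measurable_fun setT (@row_cons N).
Proof.
apply: measurable_to_Rn => i; rewrite /xcoord /row_cons /=.
rewrite (_ : _ \o _ = fun p : Rn R N * R =>
  if fintype.split (i : 'I_(1 + N)) is inr j then xcoord j p.1 else p.2);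
  last first.
  apply/funext => p /=; rewrite mxE; case: fintype.split => // j.
  by rewrite (ord1 j) mxE eqxx mulr1n.
case: fintype.split => [_|j]; first exact: measurable_snd.
exact: (measurableT_comp (measurable_xcoord j)).
Qed.

Definition lebesgue_cons N (m : {measure set (Rn R N) -> \bar R}) :
    set (Rn R N.+1) -> \bar R :=
  pushforward (m \x (@lebesgue_measure R))%E (@row_cons N).

HB.instance Definition _ N m := Measure.copy (@lebesgue_cons N m)
  (measure_function_pushforward__canonical__measure_function_Measure
    (m \x (@lebesgue_measure R))%E (@measurable_row_cons N)).

(* The N-dimensional Lebesgue measure, as an iterated product measure. *)
Fixpoint lebesgue_Rn N : {measure set (Rn R N) -> \bar R} :=
  if N is M.+1 then lebesgue_cons (lebesgue_Rn M) else dirac (0 : Rn R 0).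
End lebesgue_Rn.

Section histories.
Context (R : realType) (X : normedModType R) (tau : R).

(* The space C([-tau, 0]; X): its elements are stored as functions on R that
   vanish outside [-tau, 0], so that Leibniz equality is equality on
   [-tau, 0]. *)
Definition hist_pred : {pred (R -> X)} := fun phi =>
  `[< {within `[- tau, 0], continuous phi} /\
      forall t, t \notin `[- tau, 0] -> phi t = 0 >].

Record hist := Hist { hist_fun :> R -> X; hist_funP : hist_fun \in hist_pred }.

HB.instance Definition _ := [isSub for hist_fun].
HB.instance Definition _ := [Choice of hist by <:].

Fact hist_submod_closed : submod_closed hist_pred.
Proof.
split; first by apply/asboolP; split=> // x; exact: cvg_cst.
move=> a f g /asboolP[cf f0] /asboolP[cg g0]; apply/asboolP; split.
  by move=> x; apply: cvgD; [apply: cvgZr; exact: cf|exact: cg].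
by move=> t t0; rewrite -[LHS]/(a *: f t + g t) f0// g0// scaler0 addr0.
Qed.

HB.instance Definition _ := GRing.isSubmodClosed.Build R (R -> X) hist_pred
  hist_submod_closed.
HB.instance Definition _ := [SubChoice_isSubLmodule of hist by <:].

Definition hist_norm (phi : hist) : R :=
  sup [set `|phi t| | t in `[- tau, 0]].

Lemma hist_norm_ubound (phi : hist) t : t \in `[- tau, 0] ->
  `|phi t| <= hist_norm phi.
Proof.
move=> tI; apply: sup_ubound; last by exists t.
have /asboolP[cphi _] := hist_funP phi.
have /compact_bounded[M [_ MB]] :=
  continuous_compact cphi (@segment_compact _ (- tau) 0).
exists (M + 1) => _ [s sI <-]; apply: (MB (M + 1)); first by rewrite ltrDl.
by exists s.
Qed.

Lemma hist_norm_le (phi : hist) M : 0 <= M ->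
  (forall t, t \in `[- tau, 0] -> `|phi t| <= M) -> hist_norm phi <= M.
Proof.
move=> M0 phiM; rewrite /hist_norm.
have [->|/set0P S0] := eqVneq [set `|phi t| | t in `[- tau, 0]] set0.
  by rewrite sup0.
by apply: ge_sup => // _ [t tI <-]; exact: phiM.
Qed.

Lemma hist_norm_ge0 (phi : hist) : 0 <= hist_norm phi.
Proof.
rewrite /hist_norm.
have [->|/set0P [_ [t tI _]]] := eqVneq [set `|phi t| | t in `[- tau, 0]] set0.
  by rewrite sup0.
exact: le_trans (hist_norm_ubound phi tI).
Qed.

Fact hist_ler_normD phi psi :
  hist_norm (phi + psi) <= hist_norm phi + hist_norm psi.
Proof.
apply: hist_norm_le => [|t tI]; first by rewrite addr_ge0 ?hist_norm_ge0.
by rewrite (le_trans (ler_normD _ _))// lerD ?hist_norm_ubound.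
Qed.

Fact hist_norm_scale_le a phi : hist_norm (a *: phi) <= `|a| * hist_norm phi.
Proof.
apply: hist_norm_le => [|t tI]; first by rewrite mulr_ge0 ?hist_norm_ge0.
by rewrite -[X in `|X|]/(a *: phi t) normrZ ler_wpM2l ?hist_norm_ubound.
Qed.

Fact hist_normrZ a phi : hist_norm (a *: phi) = `|a| * hist_norm phi.
Proof.
apply/eqP; rewrite eq_le hist_norm_scale_le /=.
have [->|a0] := eqVneq a 0; first by rewrite normr0 mul0r hist_norm_ge0.
rewrite -ler_pdivlMl ?normr_gt0// -normfV.
by rewrite (le_trans _ (hist_norm_scale_le _ _))// scalerK.
Qed.

Fact hist_normr0_eq0 phi : hist_norm phi = 0 -> phi = 0.
Proof.
move=> phi0; apply/val_inj/funext => t.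
have [tI|tI] := boolP (t \in `[- tau, 0]).
  apply/eqP; rewrite -normr_eq0 eq_le normr_ge0 andbT.
  by rewrite (le_trans (hist_norm_ubound phi tI))// phi0.
by have /asboolP[_ /(_ t tI)] := hist_funP phi.
Qed.

HB.instance Definition _ := Lmodule_isNormed.Build R hist
  hist_ler_normD hist_normrZ hist_normr0_eq0.

End histories.

Section semigroups.
Context (R : realType) (X : normedModType R).

(* The Riemann integral of h over [a, b], as the limit of tagged Riemann sums
   as the mesh tends to 0. *)
Definition riemann_integral (h : R -> X) (a b : R) (l : X) : Prop :=
  forall e, 0 < e -> exists2 delta, 0 < delta &
    forall (n : nat) (p xi : nat -> R), p 0%N = a -> p n = b ->
      (forall i, (i < n)%N ->
         [/\ p i <= xi i, xi i <= p i.+1 & p i.+1 - p i < delta]) ->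
      `|\sum_(i < n) (p i.+1 - p i) *: h (xi i) - l| < e.

Record C0_semigroup (S : R -> X -> X) : Prop := {
  C0_linear : forall t, 0 <= t -> linear (S t);
  C0_continuous : forall t, 0 <= t -> continuous (S t);
  C0_id : forall x, S 0 x = x;
  C0_add : forall s t x, 0 <= s -> 0 <= t -> S (s + t) x = S s (S t x);
  C0_strong : forall x, S t x @[t --> 0^'+] --> x }.

(* Unbounded operators are represented by their graphs. *)
Definition generator (S : R -> X -> X) (x y : X) : Prop :=
  h^-1 *: (S h x - x) @[h --> 0^'+] --> y.

Definition C0_generated (A : X -> X -> Prop) (S : R -> X -> X) : Prop :=
  C0_semigroup S /\ forall x y, generator S x y <-> A x y.

Variables (S : R -> X -> X) (sigma : R) (F : X -> X) (tau : R).

(* The delay equation u'(t) = G u(t) + sigma u(t - tau) + F (u(t - tau)), where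
   G is the generator of S. *)
Record mild_solution (phi : hist X tau) (u : R -> X) : Prop := {
  mild_continuous : {within `[- tau, +oo[, continuous u};
  mild_initial : forall s, s \in `[- tau, 0] -> u s = phi s;
  mild_duhamel : forall t, 0 < t -> exists I1 I2 : X,
    [/\ riemann_integral (fun s => S (t - s) (u (s - tau))) 0 t I1,
        riemann_integral (fun s => S (t - s) (F (u (s - tau)))) 0 t I2 &
        u t = S t (phi 0) + sigma *: I1 + I2] }.

Definition solution_semigroup (Phi : R -> hist X tau -> hist X tau) : Prop :=
  forall phi, exists2 u, mild_solution phi u &
    forall t theta, 0 <= t -> theta \in `[- tau, 0] ->
      Phi t phi theta = u (t + theta).

End semigroups.

Section laplacian.
Context (R : realType) (N : nat).
Implicit Types (psi : Rn R N -> R) (Omega : set (Rn R N)).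

Fixpoint partial (s : seq 'I_N) psi : Rn R N -> R :=
  if s is i :: s' then 'D_(delta_mx 0 i : Rn R N) (partial s' psi) else psi.

Definition smooth psi : Prop := forall s x, differentiable (partial s psi) x.

Definition test_function Omega psi : Prop :=
  smooth psi /\ exists K : set (Rn R N),
    [/\ compact K, K `<=` Omega & forall x, ~ K x -> psi x = 0].

Definition laplacian psi (x : Rn R N) : R := \sum_i partial [:: i; i] psi x.

Definition lebesgue_ball (K : R) : {measure set (Rn R N) -> \bar R} :=
  mrestr (lebesgue_Rn R N) (@measurable_eball R N K).

(* In what follows m is meant to be the Lebesgue measure on Omega, so that
   L2 m is L^2(Omega). *)
Variables (m : {measure set (Rn R N) -> \bar R}) (Omega : set (Rn R N)).

(* H^1_0(Omega): the closure of the test functions for the H^1 norm. *)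
Definition H10 (u : L2 m) : Prop := exists psi : nat -> Rn R N -> R,
  [/\ forall n, test_function Omega (psi n),
      'N[m]_2%:R%:E[EFin \o (psi n \- u)%R]%E @[n --> \oo] --> 0%E &
      forall i, exists w : L2 m,
        'N[m]_2%:R%:E[EFin \o (partial [:: i] (psi n) \- w)%R]%E
          @[n --> \oo] --> 0%E].

(* The graph of the Laplacian of L^2(Omega) with domain the u in H^1_0(Omega)
   whose distributional Laplacian is in L^2(Omega): the Dirichlet Laplacian.
   When Omega is the whole space, this is the Laplacian with domain H^2. *)
Definition dirichlet_laplacian (u v : L2 m) : Prop := H10 u /\
  forall psi, test_function Omega psi ->
    \int[m]_x (u x * laplacian psi x) = \int[m]_x (v x * psi x).

End laplacian.

Notation L2_Rn R N := (L2 (lebesgue_Rn R N)).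
Notation L2_ball N K := (L2 (lebesgue_ball N K)).

Definition tail_mass (R : realType) (N : nat) (u : L2_Rn R N) (K : R) : \bar R :=
  (\int[lebesgue_Rn R N]_(x in [set x | (K <= enorm x)%R]) (u x ^+ 2)%:E)%E.

Section complexification.
Context (R : realType) (V : normedModType R).

(* (x, y) stands for x + i y. *)
Definition cplx : Type := (V * V)%type.
HB.instance Definition _ := GRing.Zmodule.on cplx.

Definition cplx_scale (a : R[i]) (z : cplx) : cplx :=
  (complex.Re a *: z.1 - complex.Im a *: z.2,
   complex.Re a *: z.2 + complex.Im a *: z.1).

Fact cplx_scaleA a b z : cplx_scale a (cplx_scale b z) = cplx_scale (a * b) z.
Proof.
case: a b => [a a'] [b b']; rewrite /cplx_scale /=; congr pair;
  rewrite !(scalerBr, scalerDr) !scalerA !(scalerBl, scalerDl) ?opprD -!addrA;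
  by congr (_ + _); rewrite [RHS]addrC -addrA.
Qed.

Fact cplx_scale1 : left_id 1 cplx_scale.
Proof.
by case=> x y; rewrite /cplx_scale /= !scale1r !scale0r subr0 addr0.
Qed.

Fact cplx_scaleDr : right_distributive cplx_scale +%R.
Proof.
move=> a z w; rewrite /cplx_scale /= !scalerDr; congr pair.
  by rewrite opprD addrACA.
by rewrite addrACA.
Qed.

Fact cplx_scaleDl z : {morph cplx_scale^~ z : a b / a + b}.
Proof.
case=> a a' [b b']; rewrite /cplx_scale /= !scalerDl; congr pair.
  by rewrite opprD addrACA.
by rewrite addrACA.
Qed.

HB.instance Definition _ := GRing.Zmodule_isLmodule.Build R[i] cplx
  cplx_scaleA cplx_scale1 cplx_scaleDr cplx_scaleDl.

Definition has_dim (E : set cplx) (n : nat) : Prop := exists b : 'I_n -> cplx,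
  (forall c : 'I_n -> R[i], \sum_i c i *: b i = 0 -> forall i, c i = 0) /\
  E = [set z | exists c : 'I_n -> R[i], z = \sum_i c i *: b i].

(* The graph of a linear operator of V, and the notions of spectral theory for
   its complexification. *)
Variable A : V -> V -> Prop.

Definition cplx_graph (z w : cplx) : Prop := A z.1 w.1 /\ A z.2 w.2.

Definition cplx_eigenvalue (lam : R[i]) : Prop :=
  exists2 z : cplx, z != 0 & cplx_graph z (lam *: z).

Fixpoint ker_pow (lam : R[i]) (k : nat) (z : cplx) : Prop :=
  if k is k'.+1 then
    exists2 w, cplx_graph z w & ker_pow lam k' (w - lam *: z)
  else z = 0.

Definition gen_eigenvectors (lam : R[i]) : set cplx :=
  [set z | exists k, ker_pow lam k z].

Definition gen_eigenspace (Lam : set R[i]) : set cplx :=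
  [set z | exists n (lam : 'I_n -> R[i]) (y : 'I_n -> cplx),
    (forall i, Lam (lam i) /\ gen_eigenvectors (lam i) (y i)) /\
    z = \sum_i y i].

(* n is the sum of the algebraic multiplicities of the eigenvalues with real
   part a. *)
Definition total_multiplicity (a : R) (n : nat) : Prop :=
  exists (s : seq R[i]) (mult : R[i] -> nat),
    [/\ uniq s, forall lam, lam \in s <->
          cplx_eigenvalue lam /\ complex.Re lam = a,
        forall lam, lam \in s -> has_dim (gen_eigenvectors lam) (mult lam) &
        n = (\sum_(lam <- s) mult lam)%N].

(* rho 1 > rho 2 > ... are the distinct real parts of the eigenvalues, and
   n j is the total multiplicity of rho j; the values at 0 are irrelevant. *)
Definition spectral_enumeration (rho : nat -> R) (n : nat -> nat) : Prop :=
  [/\ forall i j, (1 <= i < j)%N -> rho j < rho i,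
      forall a, (exists2 j, (1 <= j)%N & rho j = a) <->
                (exists2 lam, cplx_eigenvalue lam & complex.Re lam = a) &
      forall j, (1 <= j)%N -> total_multiplicity (rho j) (n j)].

Definition resolvent (z : R[i]) (x y : cplx) : Prop :=
  exists2 w, cplx_graph y w & z *: y - w = x.

Definition resolvent_set : set R[i] :=
  [set z | (forall x, exists! y, resolvent z x y) /\
    exists M : R, forall x y, resolvent z x y ->
      `|y.1| + `|y.2| <= M * (`|x.1| + `|x.2|)].

Definition spectrum : set R[i] := ~` resolvent_set.

Definition polar (r theta : R) : R[i] := Complex (r * cos theta) (r * sin theta).

(* I is (2 pi i)^-1 times the integral of (z - A)^-1 x along the circle of
   centre lam and radius r, parametrized by z = lam + polar r theta. *)
Definition riesz_integral (lam : R[i]) (r : R) (x I : cplx) : Prop :=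
  exists2 y : R -> cplx,
    forall theta, theta \in `[0, 2 * pi] ->
      resolvent (lam + polar r theta) x (y theta) &
    riemann_integral (fun theta => (polar r theta *: y theta).1)
      0 (2 * pi) ((2 * pi) *: I.1) /\
    riemann_integral (fun theta => (polar r theta *: y theta).2)
      0 (2 * pi) ((2 * pi) *: I.2).

(* P is the spectral projection onto the real part of the generalized
   eigenspace associated with the finite set Lam of eigenvalues, i.e. the sum
   of the Riesz integrals along small circles around the points of Lam. *)
Record spectral_projection (Lam : set R[i]) (P : V -> V) : Prop := {
  sproj_linear : linear P;
  sproj_continuous : continuous P;
  sproj_idem : forall x, P (P x) = P x;
  sproj_range : range P = [set x | gen_eigenspace Lam (x, 0)];
  sproj_riesz : exists (s : seq R[i]) (r : R),
    [/\ uniq s, forall lam, lam \in s <-> Lam lam, 0 < r,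
        forall lam z, lam \in s -> spectrum z -> `|z - lam| <= r%:C%C ->
          z = lam &
        forall x, exists2 I : R[i] -> cplx,
          forall lam, lam \in s -> riesz_integral lam r (x, 0) (I lam) &
          \sum_(lam <- s) I lam = (P x, 0)] }.

End complexification.

Section attractors.
Context (R : realType) (V : normedModType R).

Record global_attractor (Phi : R -> V -> V) (A : set V) : Prop := {
  attractor_compact : compact A;
  attractor_invariant : forall t, 0 <= t -> Phi t @` A = A;
  attractor_attracts : forall B : set V, bounded_set B ->
    forall e, 0 < e -> \forall t \near +oo, forall x, B x ->
      exists2 a, A a & `|Phi t x - a| < e }.

(* The minimal number of balls of radius less than e covering A; +oo if there
   is no finite cover. *)
Definition covering_number (A : set V) (e : R) : \bar R :=
  ereal_inf [set n%:R%:E | n in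
    [set n | exists (c : 'I_n -> V) (r : 'I_n -> R),
      (forall i, r i < e) /\ A `<=` \bigcup_i ball (c i) (r i)]].

Definition fractal_dim (A : set V) : \bar R :=
  limf_esup (fun e : R => lne (covering_number A e) / (- ln e)%:E)%E 0^'+.

End attractors.

(* Main.v *)
Require Import Defs.
From HB Require Import structures.
From mathcomp Require Import all_boot all_order all_algebra.
From mathcomp Require Import all_classical all_reals all_analysis.
From mathcomp Require Import measurable_realfun complex ring lra.
Set Implicit Arguments.
Unset Strict Implicit.
Unset Printing Implicit Defensive.
Import Order.TTheory GRing.Theory Num.Theory.
Import numFieldNormedType.Exports.
Local Open Scope classical_set_scope.
Local Open Scope ring_scope.

(** The hypothesis zeta < 1 makes the attractor a single point. Dropping
    nonnegative terms from zeta < 1 leaves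
    [exp (a tau) (sigma + Lf^2) < a (1 - tau)] with [a = mu - sigma - 1], and
    [Km exp (rho m) < 1].

    If [tau > 1], then [U 1 x] still contains the values of [x] on
    [[1 - tau, 0]]. As [P] has finite rank, some nonzero [x] supported there
    satisfies [P x = 0], so that [|x| <= |U 1 (x - P x)| <= Km exp (rho m) |x|]:
    this contradicts [Km exp (rho m) < 1], and [tau = 1] is excluded by the
    first inequality.

    If [tau < 1], then [a > 0] and the first inequality gives
    [sigma + Lf < mu]. The Laplacian is dissipative, hence
    [|S t x| <= exp (- mu t) |x|], and the variation of constants formula shows
    that two trajectories in the attractor at distance at most [M] for all times
    are eventually at distance at most about [(sigma + Lf) / mu * M < M]. *)

(** The bound claimed for the dimension is nonnegative and a single point has dimension at most 0,
    so the collapse of the attractor is the whole content. The exponential decay of [S] is the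
    costly step: [S] is known only through its generator. Integrating by parts against test
    functions makes the Laplacian dissipative, which gives the backward Euler inequality (1 + h mu)
    |x| <= |x - h (Laplacian x - mu x)| on the domain; since norms of orbits need not be
    differentiable, it is integrated through one-sided difference quotients. Two facts about orbits
    are taken from the mild solutions, which exist for every history: their continuity at positive
    times ([C0_strong] speaks of time 0) and the existence of their Riemann integrals, from which
    the density of the domain follows. For this, histories are chosen so that Duhamel's formula
    isolates the wanted orbit. *)

Section Rn_borel.

(** * Borel sets of R^N *)

Context (R : realType) (N : nat).

Lemma xcoord_le_norm (i : 'I_N) (x : Rn R N) : `|xcoord i x| <= `|x|.
Proof.
have /mapP[j _ ->] : `|xcoord i x| \in [seq `|x y.1 y.2| | y : 'I_1 * 'I_N].
  by apply/mapP; exists (ord0, i) => //=; rewrite mem_enum.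
by rewrite [leRHS]/Num.norm /= mx_normrE; apply/bigmax_geP; right => /=; exists j.
Qed.

Lemma Rn_norm_le (x : Rn R N) (B : R) : 0 <= B ->
  (`|x| <= B) = [forall i, `|xcoord i x| <= B].
Proof.
move=> B0; apply/idP/forallP => [xB i|xB];
  first exact: le_trans (xcoord_le_norm _ _) xB.
rewrite [leLHS]/Num.norm /= mx_normrE; apply/bigmax_leP; split => // -[i j] _ /=.
by rewrite (ord1 i); exact: xB.
Qed.

Lemma measurable_Rn_ball (x : Rn R N) (e : R) : 0 < e ->
  measurable (ball x e : set (Rn R N)).
Proof.
move=> e0.
rewrite (_ : ball x e = \bigcap_(i in [set: 'I_N]) (xcoord i @^-1` ball (xcoord i
  x) e)).
  apply: fin_bigcap_measurable => // i _.
  rewrite -[X in measurable X]setTI; apply: measurable_xcoord => //.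
  exact: measurable_ball.
apply/seteqP; split => [y [_ xy] i _|y xy]; first exact: xy.
by split=> // i j; rewrite (ord1 i); exact: xy.
Qed.

(** The sigma-algebra is generated by the coordinates, whereas openness refers to the max norm,
    whose balls are boxes. An open set is a countable union of boxes with rational centres and radii
    1/(n+1); indices whose box is not contained in [U] contribute the empty set. *)
Lemma open_measurable_Rn (U : set (Rn R N)) : open U -> measurable U.
Proof.
move=> oU.
pose q (p : 'rV[rat]_N * nat) : Rn R N := map_mx ratr p.1.
pose D := [set p | ball (q p) p.2.+1%:R^-1 `<=` U].
rewrite (_ : U = \bigcup_(p in [set: 'rV[rat]_N * nat])
  if `[< D p >] then ball (q p) p.2.+1%:R^-1 else set0).
  apply: (@countable_bigcupT_measurable _ _ _ (fun p =>
    if `[< D p >] then ball (q p) p.2.+1%:R^-1 else set0)) => // p.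
  by case: ifP => // _; apply: measurable_Rn_ball; rewrite invr_gt0.
apply/seteqP; split => [x Ux|x [p _]]; last by case: ifP => // /asboolP; exact.
have /nbhs_ballP[_/posnumP[e] eU] := open_nbhs_nbhs (conj oU Ux).
(* The radius is below e/2, so a box of this radius that contains [x] stays within e of [x]. *)
pose n := Num.truncn (2 / e%:num).
have n1 : n.+1%:R^-1 < e%:num / 2 :> R.
  by rewrite -[ltRHS]invf_div ltf_pV2 ?posrE// truncnS_gt.
have qx i : exists r : rat, `|xcoord i x - ratr r| < n.+1%:R^-1.
  have /rat_in_itvoo[r] : xcoord i x - n.+1%:R^-1 < xcoord i x + n.+1%:R^-1.
    by rewrite ltrD2l gt0_cp.
  by rewrite in_itv /= => rx; exists r; rewrite distrC ltr_distl.
pose p : 'rV[rat]_N * nat := (\row_i projT1 (cid (qx i)), n).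
have xp : ball (q p) p.2.+1%:R^-1 x.
  split; rewrite ?invr_gt0// => i j; rewrite /q /= !mxE (ord1 i) /ball /= distrC.
  by have := projT2 (cid (qx j)).
exists p => //; case: ifPn => // /asboolP; apply => y py; apply: eU.
apply: (@ball_splitr _ _ (q p)); apply: le_ball (ltW n1) _ _ => //.
Qed.

Lemma continuous_measurable_Rn (f : Rn R N -> R) :
  continuous f -> measurable_fun setT f.
Proof.
move=> /continuousP cf; apply: (measurability _ (RGenOpens.measurableE R)).
move=> _ [_ [a [b ->] <-]]; rewrite setTI; apply: open_measurable_Rn; exact: cf.
Qed.

Lemma measurable_Rn_norm_le (B : R) : measurable [set x : Rn R N | `|x| <= B].
Proof.
rewrite -[X in measurable X]setTI.
have := continuous_measurable_Rn (@norm_continuous _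
  (Rn R N)) measurableT (measurable_itv `]-oo, B]).
by congr (measurable (_ `&` _)); apply/seteqP; split=> x /=; rewrite in_itv.
Qed.

Lemma compact_Rn_norm_le (B : R) : compact [set x : Rn R N | `|x| <= B].
Proof.
apply: bounded_closed_compact.
  by exists B; split; [exact: num_real|move=> M BM x /= /le_trans; apply; exact: ltW].
have := closed_comp (in1W (@norm_continuous _ (Rn R N))) (@closed_le R B).
by [].
Qed.

End Rn_borel.

(** * Splitting off the first coordinate of R^(N+1) *)

Section Rn_cons.
Context (R : realType) (N : nat).
Implicit Types (p : Rn R N * R).

Lemma xcoord_row_cons0 p : xcoord ord0 (row_cons p) = p.2.
Proof.
have := row_mxEl (p.2%:M : 'M[R]_1) (p.1 : 'rV[R]_N) ord0 ord0.
rewrite [RHS]mxE eqxx mulr1n => <-; rewrite /xcoord /row_cons.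
by congr (fun_of_matrix _ _ _); apply: val_inj.
Qed.

Lemma xcoord_row_cons_lift p i : xcoord (lift ord0 i) (row_cons p) = xcoord i p.1.
Proof.
have := row_mxEr (p.2%:M : 'M[R]_1) (p.1 : 'rV[R]_N) ord0 i.
by rewrite /xcoord => <-; congr (fun_of_matrix _ _ _); apply: val_inj.
Qed.

Lemma xcoord_inj n (x y : Rn R n) : (forall i, xcoord i x = xcoord i y) -> x = y.
Proof. by move=> xy; apply/rowP. Qed.

Lemma norm_row_cons p : `|row_cons p| = Num.max `|p.1| `|p.2|.
Proof.
apply/eqP; rewrite eq_le; apply/andP; split.
  rewrite Rn_norm_le ?le_max ?normr_ge0//; apply/forallP => i.
  case: (unliftP ord0 i) => [j|] ->.
    by rewrite xcoord_row_cons_lift le_max xcoord_le_norm.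
  by rewrite xcoord_row_cons0 le_max lexx orbT.
rewrite ge_max -[X in _ && (`|X| <= _)]xcoord_row_cons0 xcoord_le_norm andbT.
rewrite Rn_norm_le//; apply/forallP => i.
by rewrite -(xcoord_row_cons_lift p) xcoord_le_norm.
Qed.

End Rn_cons.

(** * Sigma-finiteness of the Lebesgue measure *)

Section Rn_measure.
Context (R : realType).

(* A name for the underlying set function of lebesgue_Rn, to which a
   sigma-finiteness instance can be attached. *)
Definition lebesgueRn N : set (Rn R N) -> \bar R := lebesgue_Rn R N.
HB.instance Definition _ N := Measure.copy (@lebesgueRn N) (lebesgue_Rn R N).

(** A max-norm ball of R^(N+1) is the product of a max-norm ball of R^N with an interval, so
    induction follows the iterated product measure. *)
Lemma lebesgueRn_ball_fin N (B : R) :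
  (lebesgueRn [set x : Rn R N | `|x| <= B]%R < +oo)%E.
Proof.
elim: N => [|N IH]; first by rewrite /lebesgueRn /= /dirac indicE ltry.
have [B0|B0] := ltP B 0.
  rewrite (_ : [set _ | _] = set0) ?measure0 ?ltry//.
  by apply/seteqP; split => // x /= xB; have := le_lt_trans xB B0; rewrite normr_lt0.
have -> : lebesgueRn [set x : Rn R N.+1 | `|x| <= B] =
  (lebesgue_Rn R N \x (@lebesgue_measure R))%E ([set x : Rn R N | `|x| <= B] `*`
    `[- B, B]%classic)%R.
  rewrite /lebesgueRn /= /lebesgue_cons /pushforward; congr (_ _).
  apply/seteqP; split => [p|p [/= p1 p2]]; rewrite /= norm_row_cons ge_max.
    by case/andP => p1 p2; split => //=; rewrite in_itv /= -ler_norml.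
  by move: p2; rewrite p1 /= in_itv /= -ler_norml.
rewrite product_measure1E//; last exact: measurable_Rn_norm_le.
rewrite lte_mul_pinfty//.
  by rewrite ge0_fin_numE//; exact: IH.
by rewrite /= lebesgue_measure_itv /=; case: ifP; rewrite ltry.
Qed.

Lemma lebesgueRn_sigma_finite N : sigma_finite [set: Rn R N] (@lebesgueRn N).
Proof.
exists (fun n => [set x : Rn R N | `|x| <= n%:R]).
  apply/seteqP; split => // x _; exists (Num.truncn `|x|).+1 => //=.
  exact/ltW/truncnS_gt.
by move=> n; split; [exact: measurable_Rn_norm_le|exact: lebesgueRn_ball_fin].
Qed.

HB.instance Definition _ N := Measure_isSigmaFinite.Build _ _ _ (@lebesgueRn N)
  (@lebesgueRn_sigma_finite N).

End Rn_measure.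

(** * Integrals of derivatives of compactly supported functions *)

Lemma derive_eq0_near (R : realType) (V : normedModType R) (F : V -> R) (x v : V) :
  (\forall y \near x, F y = 0) -> 'D_v F x = 0.
Proof.
move=> F0; apply: cvg_lim => //; apply: cvg_near_cst.
have Fx : F x = 0 := nbhs_singleton F0.
have c : (h *: v + x) @[h --> (0 : R)] --> x.
  rewrite -[X in _ --> X]add0r -(scale0r v).
  by apply: cvgD; [apply: cvgZr_tmp; exact: cvg_id|exact: cvg_cst].
have {}c : (h *: v + x) @[h --> (0 : R)^'] --> x.
  by apply: cvg_trans c; exact: (cvg_app _ (cvg_within _)).
have : \forall h \near (0 : R)^', F (h *: v + x) = 0 := c _ F0.
apply: filterS => h /= Fh; by rewrite Fh Fx subrr scaler0.
Qed.

Lemma derive_eq0_gt_norm (R : realType) (V : normedModType R) (F : V ->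
  R) (B : R) (v x : V) :
  (forall x, B < `|x| -> F x = 0) -> B < `|x| -> 'D_v F x = 0.
Proof.
move=> F0 Bx; apply: derive_eq0_near.
have : \forall y \near x, B < `|y| by apply: (cvgr_gt `|x|) => //;
  exact: norm_continuous.
by apply: filterS => y /=; exact: F0.
Qed.

Lemma integral_derive_eq0 (R : realType) (F : R -> R) (B : R) :
  (forall x, derivable F x 1) -> continuous ('D_1 F) ->
  (forall x, B < `|x| -> F x = 0) ->
  (\int[@lebesgue_measure R]_x ('D_1 F x)%:E = 0)%E.
Proof.
(* [B] may be negative; [C] is positive and exceeds it, so [F] vanishes at both endpoints. *)
move=> dF cF F0; pose C : R := `|B| + 1.
have BC : B < C by rewrite (le_lt_trans (ler_norm _))// ltrDl.
have C0 : 0 < C by rewrite ltr_wpDl.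
have FC : F C = 0 by rewrite F0// gtr0_norm.
have FNC : F (- C) = 0 by rewrite F0// normrN gtr0_norm.
have contF : continuous F.
  by move=> x; apply: differentiable_continuous; apply/derivable1_diffP; exact: dF.
transitivity (\int[@lebesgue_measure R]_(x in `[(- C)%R, C]) ('D_1 F x)%:E)%E.
  rewrite [RHS]integral_mkcond; apply: eq_integral => x _.
  rewrite patchE; case: ifPn => //; rewrite notin_setE /= in_itv /= -ler_norml => /negP.
  rewrite -ltNge => Cx; congr EFin; apply: derive_eq0_gt_norm F0 _.
  exact: lt_trans Cx.
rewrite (@continuous_FTC2 _ _ F).
- by rewrite FC FNC sube0.
- by rewrite -subr_gt0 opprK addr_gt0.
- exact: continuous_subspaceT.
- split; first by move=> x _; exact: dF.
    by apply: cvg_at_right_filter; exact: contF.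
  by apply: cvg_at_left_filter; exact: contF.
- by move=> x _; rewrite derive1E.
Qed.

Lemma nonexpansive_continuous (R : realType) (V W : normedModType R) (f : V -> W) :
  (forall y z, `|f y - f z| <= `|y - z|) -> continuous f.
Proof.
move=> fl y; apply/cvgrPdist_lt => e e0; near=> z; apply: le_lt_trans (fl _ _) _.
by near: z; apply: cvgr_dist_lt => //; exact: cvg_id.
Unshelve. all: by end_near. Qed.

Section Rn_partial.
Context (R : realType).

Definition unit_vec N (i : 'I_N) : Rn R N := delta_mx 0 i.

Lemma xcoordD N (i : 'I_N) (x y : Rn R N) : xcoord i (x + y) = xcoord i x + xcoord i y.
Proof. exact: mxE. Qed.

Lemma xcoordZ N (i : 'I_N) (a : R) (x : Rn R N) : xcoord i (a *: x) = a * xcoord i x.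
Proof. exact: mxE. Qed.

Lemma xcoord_unit_vec N (i j : 'I_N) : xcoord j (unit_vec i) = (j == i)%:R.
Proof. by rewrite /xcoord mxE. Qed.

Lemma row_consD N (p q : Rn R N * R) : row_cons (p + q) = row_cons p + row_cons q.
Proof.
apply: xcoord_inj => i; rewrite xcoordD.
by case: (unliftP ord0 i) => [j|] ->;
  rewrite !(xcoord_row_cons_lift, xcoord_row_cons0)// xcoordD.
Qed.

Lemma row_consB N (p q : Rn R N * R) : row_cons p - row_cons q = row_cons (p - q).
Proof. by apply/eqP; rewrite subr_eq -row_consD subrK. Qed.

Lemma continuous_row_consl N (t : R) : continuous (fun y : Rn R N => row_cons (y, t)).
Proof.
apply: nonexpansive_continuous => z w; rewrite row_consB norm_row_cons /=.
by rewrite subrr normr0 ge_max lexx normr_ge0.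
Qed.

Lemma continuous_row_consr N (y : Rn R N) : continuous (fun t : R => row_cons (y, t)).
Proof.
apply: nonexpansive_continuous => z w; rewrite row_consB norm_row_cons /=.
by rewrite subrr normr0 ge_max lexx normr_ge0.
Qed.

Lemma row_cons_unit_vec_lift N (i : 'I_N) h (y : Rn R N) t :
  h *: unit_vec (lift ord0 i) + row_cons (y, t) = row_cons (h *: unit_vec i + y, t).
Proof.
apply: xcoord_inj => j; rewrite xcoordD xcoordZ xcoord_unit_vec.
case: (unliftP ord0 j) => [k|] ->; rewrite ?xcoord_row_cons_lift ?xcoord_row_cons0 /=.
  by rewrite xcoordD xcoordZ xcoord_unit_vec (inj_eq lift_inj).
by rewrite mulr0 add0r.
Qed.

Lemma row_cons_unit_vec0 N h (y : Rn R N) t :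
  h *: unit_vec ord0 + row_cons (y, t) = row_cons (y, h + t).
Proof.
apply: xcoord_inj => j; rewrite xcoordD xcoordZ xcoord_unit_vec.
case: (unliftP ord0 j) => [k|] ->; rewrite ?xcoord_row_cons_lift ?xcoord_row_cons0 /=.
  by rewrite mulr0 add0r.
by rewrite mulr1.
Qed.

(** Stated for the difference quotients themselves, so that one rewriting settles both the existence
    and the value of the partial derivative of a slice. *)
Lemma growth_slice_lift N (F : Rn R N.+1 -> R) (i : 'I_N) (y : Rn R N) t :
  (fun h : R => h^-1 *: ((F \o shift (row_cons (y, t))) (h *: unit_vec (lift ord0
    i)) - F (row_cons (y, t)))) =
  (fun h : R => h^-1 *: (((fun y =>
    F (row_cons (y, t))) \o shift y) (h *: unit_vec i) - F (row_cons (y, t)))).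
Proof. by apply/funext => h /=; rewrite row_cons_unit_vec_lift. Qed.

Lemma growth_slice0 N (F : Rn R N.+1 -> R) (y : Rn R N) t :
  (fun h : R => h^-1 *: ((F \o shift (row_cons (y, t))) (h *: unit_vec ord0) - F
    (row_cons (y, t)))) =
  (fun h : R => h^-1 *: (((fun t =>
    F (row_cons (y, t))) \o shift t) (h *: 1) - F (row_cons (y, t)))).
Proof. by apply/funext => h /=; rewrite row_cons_unit_vec0 [_ *: 1]mulr1. Qed.

Lemma integrable_continuous_support N (G : Rn R N -> R) (B : R) :
  continuous G -> (forall x, B < `|x| -> G x = 0) ->
  (lebesgue_Rn R N).-integrable setT (EFin \o G).
Proof.
move=> cG G0; pose E := [set x : Rn R N | `|x| <= B].
have mE : measurable E by exact: measurable_Rn_norm_le.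
have iE : (lebesgue_Rn R N).-integrable E (EFin \o G).
  apply: measurable_bounded_integrable => //.
  - exact: lebesgueRn_ball_fin.
  - by apply: measurable_funTS; exact: continuous_measurable_Rn.
  - have /compact_bounded[M [Mr MG]] : compact (G @` E).
      apply: continuous_compact; last exact: compact_Rn_norm_le.
      exact: continuous_subspaceT.
    by exists M; split => // K MK x Ex; apply: (MG K MK); exists x.
move/integrable_mkcond : iE => /(_ mE).
congr (_.-integrable _ _); apply/funext => x; rewrite patchE; case: ifPn => //.
by rewrite notin_setE /= => /negP; rewrite -ltNge => /G0 ->.
Qed.

(** Induction on N with Fubini's theorem, the inner integral running over the group of variables
    that contains the direction of differentiation: the fundamental theorem of calculus serves for
    the new coordinate, the induction hypothesis for the others. *)
Lemma integral_partial_eq0 N (F : Rn R N -> R) (i : 'I_N) (B : R) :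
  (forall x, derivable F x (unit_vec i)) -> continuous ('D_(unit_vec i) F) ->
  (forall x, B < `|x| -> F x = 0) ->
  (\int[lebesgue_Rn R N]_x ('D_(unit_vec i) F x)%:E = 0)%E.
Proof.
elim: N => [|N IH] in F i *; first by case: i.
move=> dF cF F0; pose G := 'D_(unit_vec i) F.
have G0 x : B < `|x| -> G x = 0 by exact: derive_eq0_gt_norm.
have mG : measurable_fun setT G by exact: continuous_measurable_Rn.
have mrc := @measurable_row_cons R N.
have iG : (lebesgueRn (N:=N) \x (@lebesgue_measure R))%E.-integrable setT ((EFin
  \o G) \o (@row_cons R N)).
  have := integrable_continuous_support cF G0.
  move=> /integrableP[_ iG]; apply/integrableP; split.
    by apply: measurableT_comp => //; apply/measurable_EFinP.
  move: iG; rewrite /= /lebesgue_cons ge0_integral_pushforward//.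
  by do 2 apply: measurableT_comp => //.
rewrite /= /lebesgue_cons integral_pushforward//=; last by apply/measurable_EFinP.
rewrite preimage_setT.
case: (unliftP ord0 i) => [j|] ij.
  rewrite -(integral21_prod_meas1 iG) integral0_eq// => t _.
  rewrite /= /fubini_G /= /G ij.
  under eq_integral do rewrite /derive growth_slice_lift.
  apply: (IH (fun y => F (row_cons (y, t))) j).
  - by move=> y; have := dF (row_cons (y, t)); rewrite ij /derivable growth_slice_lift.
  - rewrite (_ : 'D_ _ _ = G \o (fun y => row_cons (y, t))).
      move=> y; apply: continuous_comp; [exact: continuous_row_consl|exact: cF].
    by apply/funext => y; rewrite /G /= ij /derive growth_slice_lift.
  - by move=> y By; apply: F0; rewrite norm_row_cons lt_max By.
rewrite -(integral12_prod_meas1 iG) integral0_eq// => y _.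
rewrite /= /fubini_F /= /G ij.
under eq_integral do rewrite /derive growth_slice0.
apply: (@integral_derive_eq0 _ (fun t => F (row_cons (y, t))) B).
- by move=> t; have := dF (row_cons (y, t)); rewrite ij /derivable growth_slice0.
- rewrite (_ : 'D_ _ _ = G \o (fun t => row_cons (y, t))).
    move=> t; apply: continuous_comp; [exact: continuous_row_consr|exact: cF].
  by apply/funext => t; rewrite /G /= ij /derive growth_slice0.
- by move=> t Bt; apply: F0; rewrite norm_row_cons lt_max Bt orbT.
Qed.

End Rn_partial.

(** * The L2 inner product *)

Section L2_inner_product.
Context d (T : measurableType d) (R : realType) (mu : {measure set T -> \bar R}).
Implicit Types f g h : T -> R.
Local Notation Lf2 := (Lfun mu 2%:R%:E).
Local Notation nrm f := (fine 'N[mu]_2%:R%:E[EFin \o f]).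

(** Pairs plain functions rather than classes, so that test functions, their derivatives and
    representatives of elements of [L2] can be mixed. *)
Definition ip f g : R := \int[mu]_x (f x * g x).

Lemma ipC f g : ip f g = ip g f.
Proof. by apply: eq_Rintegral => x _; rewrite mulrC. Qed.

Lemma Lfun2_lin a f g : f \in Lf2 -> g \in Lf2 -> a *: f + g \in Lf2.
Proof. exact: (Lfun_submod_closed mu (lee1n 2)).2. Qed.

Lemma Lfun2_0 : (0 : T -> R) \in Lf2.
Proof. exact: (Lfun_submod_closed mu (lee1n 2)).1. Qed.

Lemma Lfun2D f g : f \in Lf2 -> g \in Lf2 -> f + g \in Lf2.
Proof. by move=> fL gL; rewrite -[f]scale1r; exact: Lfun2_lin. Qed.

Lemma Lfun2_sum (I : Type) (r : seq I) (P : pred I) (F : I -> T -> R) :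
  (forall i, F i \in Lf2) -> \sum_(i <- r | P i) F i \in Lf2.
Proof. by move=> FL; apply: (big_ind (fun f => f \in Lf2)) => [||i _];
  [exact: Lfun2_0|exact: Lfun2D|exact: FL]. Qed.

Lemma Lfun2_mul_integrable f g : f \in Lf2 -> g \in Lf2 ->
  mu.-integrable setT (EFin \o (fun x => f x * g x)).
Proof. by move=> fL gL; apply/Lfun1_integrable; exact: Lfun2_mul_Lfun1. Qed.

Lemma ip_lin a f g h : f \in Lf2 -> g \in Lf2 -> h \in Lf2 ->
  ip (a *: f + g) h = a * ip f h + ip g h.
Proof.
move=> fL gL hL; rewrite /ip -RintegralZl//; last exact: Lfun2_mul_integrable.
rewrite -RintegralD//.
- by apply: eq_Rintegral => x _; rewrite -[(_ + _) x]/(a * f x + g x) mulrDl mulrA.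
- have := @Lfun2_mul_integrable (a *: f + 0) h (Lfun2_lin _ fL Lfun2_0) hL.
  congr (_.-integrable _ _); apply/funext => x /=.
  by rewrite -[(_ + _) x]/(a * f x + 0) addr0 mulrA.
- exact: Lfun2_mul_integrable.
Qed.

Lemma ip0 h : ip 0 h = 0.
Proof. by rewrite /ip /Rintegral integral0_eq// => x _ /=; rewrite mul0r. Qed.

Lemma ip_sum (I : Type) (r : seq I) (F : I -> T -> R) h :
  (forall i, F i \in Lf2) -> h \in Lf2 ->
  ip (\sum_(i <- r) F i) h = \sum_(i <- r) ip (F i) h.
Proof.
move=> FL hL; elim: r => [|i r IH]; first by rewrite !big_nil ip0.
rewrite !big_cons -IH -[F i]scale1r ip_lin ?mul1r ?scale1r//.
exact: Lfun2_sum.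
Qed.

Lemma Lfun2_nrmE f : f \in Lf2 -> ((nrm f)%:E = 'N[mu]_2%:R%:E[EFin \o f])%E.
Proof.
move=> /sub_Lfun_finLfun; rewrite inE /finite_norm /= => ff.
by rewrite fineK// ge0_fin_numE// Lnorm_ge0.
Qed.

Lemma measurable_Lfun2 f : f \in Lf2 -> measurable_fun setT f.
Proof. by move=> /sub_Lfun_mfun; rewrite inE. Qed.

Lemma ip_cauchy_schwarz f g : f \in Lf2 -> g \in Lf2 -> `|ip f g| <= nrm f * nrm g.
Proof.
move=> fL gL; have ifg := Lfun2_mul_integrable fL gL.
rewrite -lee_fin EFin_normr_Rintegral//; apply: le_trans.
  by apply: le_abse_integral => //; case/integrableP: ifg.
rewrite EFinM !Lfun2_nrmE//.
have := @hoelder _ _ _ mu f g 2 2 (measurable_Lfun2 fL) (measurable_Lfun2 gL).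
rewrite Lnorm1; apply => //.
by rewrite [RHS]splitr !div1r.
Qed.

Lemma ip_self f : f \in Lf2 -> ip f f = nrm f ^+ 2.
Proof.
move=> fL; have : (ip f f)%:E = ((nrm f ^+ 2)%:E)%E; last by case.
have -> : ((nrm f ^+ 2)%:E = 'N[mu]_2%:R%:E[EFin \o f] `^ 2%:R)%E.
  rewrite -(congr1 (fun z => z `^ 2%:R)%E (Lfun2_nrmE fL)) /=.
  by rewrite powR_mulrn// fine_ge0 ?Lnorm_ge0.
rewrite powR_Lnorm//.
rewrite /ip /Rintegral fineK; last first.
  by apply: integrable_fin_num => //; exact: Lfun2_mul_integrable.
apply: eq_integral => x _.
by rewrite /= powR_mulrn// -normrX ger0_norm ?sqr_ge0.
Qed.

Lemma ip_cvg (F : nat -> T -> R) f h :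
  (forall n, F n \in Lf2) -> f \in Lf2 -> h \in Lf2 ->
  'N[mu]_2%:R%:E[EFin \o (F n \- f)%R]%E @[n --> \oo] --> 0%E ->
  ip (F n) h @[n --> \oo] --> ip f h.
Proof.
move=> FL fL hL /fine_cvg /= F0.
have {}F0 : nrm (F n \- f) * nrm h @[n --> \oo] --> 0.
  by rewrite -(mul0r (nrm h)); apply: cvgM => //; exact: cvg_cst.
have FfE n : F n \- f = -1 *: f + F n.
  by apply/funext => x /=; rewrite -[(_ + _) x]/(-1 * f x + F n x) mulN1r addrC.
have FfL n : F n \- f \in Lf2 by rewrite FfE Lfun2_lin.
apply/cvgrPdist_lt => e e0; near=> n.
apply: (@le_lt_trans _ _ (nrm (F n \- f) * nrm h)).
  apply: le_trans (ip_cauchy_schwarz (FfL n) hL).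
  by rewrite FfE ip_lin// mulN1r -normrN opprB addrC.
apply: le_lt_trans (ler_norm _) _; near: n.
exact: (cvgr0_norm_lt _ F0).
Unshelve. all: by end_near. Qed.

End L2_inner_product.

Section L2_inner_product_quotient.
Context d (T : measurableType d) (R : realType) (mu : {measure set T -> \bar R}).
Implicit Types u v w : L2 mu.
Local Open Scope quotient_scope.

Lemma L2_Lfun2 u : (u : T -> R) \in Lfun mu 2%:R%:E.
Proof. exact: LfunP. Qed.

Lemma L2_linE a u v : {ae mu, forall x, (a *: u + v : L2 mu) x = (a *: (u : T ->
  R) + (v : T -> R)) x}.
Proof.
have [u' u'E] := L2_pi_surj u; have [v' v'E] := L2_pi_surj v.
have E : a *: u + v = \pi_(L2 mu) (a *: u' + v').
  by rewrite u'E v'E [a *: \pi_(L2 mu) u']L2_pi_scale -raddfD.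
rewrite E; move: (L2_piE (a *: u' + v')) (L2_piE u') (L2_piE v').
rewrite -u'E -v'E; apply: filterS3 => x -> ux vx.
by rewrite -[LHS]/(a * u' x + v' x) -ux -vx.
Qed.

Lemma L2_ip_lin a u v w : ip mu (a *: u + v : L2 mu) w = a * ip mu u w + ip mu v w.
Proof.
rewrite -ip_lin ?L2_Lfun2//; congr fine; apply: ae_eq_integral => //.
- by apply/measurable_EFinP/measurable_funM; apply: measurable_Lfun2; exact: L2_Lfun2.
- apply/measurable_EFinP/measurable_funM; last exact/measurable_Lfun2/L2_Lfun2.
  by apply/measurable_Lfun2/Lfun2_lin; exact: L2_Lfun2.
- by have := L2_linE a u v; apply: filterS => x -> _.
Qed.

Lemma L2_normE u : `|u| = fine 'N[mu]_2%:R%:E[EFin \o u].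
Proof. by []. Qed.

(** Pairing u - h v with u gives at least |u|^2, and Cauchy-Schwarz bounds this pairing by |u - h v|
    |u|. *)
Lemma norm_le_of_ip_le0 u v h : 0 <= h -> ip mu v u <= 0 -> `|u| <= `|u - h *: v|.
Proof.
move=> h0 vu; have [->|u0] := eqVneq u 0; first by rewrite normr0.
rewrite -(ler_pM2r (_ : 0 < `|u|)) ?normr_gt0// -expr2.
rewrite {1}L2_normE -ip_self ?L2_Lfun2//.
apply: le_trans (ip_cauchy_schwarz (L2_Lfun2 _) (L2_Lfun2 u)).
apply: le_trans (ler_norm _).
by rewrite addrC -scaleNr L2_ip_lin lerDr mulNr oppr_ge0 mulr_ge0_le0.
Qed.

End L2_inner_product_quotient.

(** * Dissipativity of the Dirichlet Laplacian *)

Section dirichlet_dissipative.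
Context (R : realType) (N : nat).
Local Notation m := (lebesgue_Rn R N).
Implicit Types psi phi : Rn R N -> R.

Lemma continuous_support_Lfun2 psi B : continuous psi ->
  (forall x, B < `|x| -> psi x = 0) -> psi \in Lfun m 2%:R%:E.
Proof.
move=> cpsi psi0; apply/andP; split; rewrite inE /=.
  exact: continuous_measurable_Rn.
have cpsi2 : continuous (psi * psi) by move=> x; apply: continuousM; exact: cpsi.
have /integrableP[_] : m.-integrable setT (EFin \o (psi * psi)).
  by apply: (integrable_continuous_support (B := B) cpsi2) => x /psi0 E;
    rewrite -[LHS]/(psi x * psi x) E mul0r.
rewrite /finite_norm unlock => fin; apply: poweR_lty; apply: le_lt_trans fin.
rewrite le_eqVlt; apply/orP; left; apply/eqP; apply: eq_integral => x _.
by rewrite /= powR_mulrn// -normrX expr2.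
Qed.

Section test_function.
Variable psi : Rn R N -> R.
Hypothesis tpsi : test_function setT psi.

Lemma test_function_continuous s : continuous (partial s psi).
Proof. by move=> x; apply: differentiable_continuous; exact: tpsi.1. Qed.

(** One bound serves all orders: the set |x| > B is open, so derivatives vanish there along with the
    function. *)
Lemma test_function_support : exists B, forall s x, B < `|x| -> partial s psi x = 0.
Proof.
have [_ [K [cK _ psi0]]] := tpsi.
have [M [Mr MK]] := compact_bounded cK.
exists (M + 1) => s; elim: s => [|i s IH] x Bx /=; last exact: derive_eq0_gt_norm Bx.
apply: psi0 => Kx; have := MK (M + 1).
by rewrite ltrDl ltr01 => /(_ isT x Kx) /=; rewrite leNgt Bx.
Qed.

Lemma test_function_Lfun2 s : partial s psi \in Lfun m 2%:R%:E.
Proof.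
have [B B0] := test_function_support.
exact: continuous_support_Lfun2 (@test_function_continuous s) (B0 s).
Qed.

Lemma laplacianE : laplacian psi = \sum_i partial [:: i; i] psi.
Proof. by apply/funext => x; rewrite fct_sumE. Qed.

Lemma laplacian_Lfun2 : laplacian psi \in Lfun m 2%:R%:E.
Proof. by rewrite laplacianE; apply: Lfun2_sum => i; exact: test_function_Lfun2. Qed.

End test_function.

(** Integration by parts: [psi] times the derivative of [phi] has compact support, so the integral
    of its partial derivative is 0. *)
Lemma ip_partial psi phi i : test_function setT psi -> test_function setT phi ->
  ip m psi (partial [:: i; i] phi) = - ip m (partial [:: i] psi) (partial [:: i] phi).
Proof.
move=> tpsi tphi.
have [B psi0] := test_function_support tpsi.
have dpsi x v : derivable psi x v by apply: diff_derivable; exact: (tpsi.1 [::]).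
have dphi x v : derivable (partial [:: i] phi) x v by apply: diff_derivable;
  exact: tphi.1.
pose F := psi * partial [:: i] phi.
have DF : 'D_(unit_vec R i) F = psi * partial [:: i;
  i] phi + partial [:: i] psi * partial [:: i] phi.
  by apply/funext => x; rewrite deriveM// addrC mulrC addrC; congr (_ + _);
    rewrite mulrC.
have : (\int[m]_x ('D_(unit_vec R i) F x)%:E = 0)%E.
  apply: (integral_partial_eq0 (B := B)).
  - by move=> x; exact: derivableM.
  - rewrite DF => x; apply: continuousD; apply: continuousM;
      solve [exact: (test_function_continuous tpsi (s :=
        [::]))|exact: test_function_continuous].
  - by move=> x /(psi0 [::]) /= E;
    rewrite -[LHS]/(psi x * partial [:: i] phi x) E mul0r.
move=> E; apply/eqP; rewrite -addr_eq0 /ip -RintegralD//.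
- apply/eqP; rewrite -[RHS](congr1 fine E); congr fine.
  by apply: eq_integral => x _; congr EFin; exact: (esym (congr1 (@^~ x) DF)).
- apply: Lfun2_mul_integrable;
  [exact: (test_function_Lfun2 tpsi [::])|exact: test_function_Lfun2].
- apply: Lfun2_mul_integrable; exact: test_function_Lfun2.
Qed.

(** In the limit <v, u> = - sum_i |w_i|^2, where w_i is the L2 limit of the i-th derivatives of the
    test functions approximating [u]. *)
Lemma dirichlet_ip_le0 (u v : L2 m) : dirichlet_laplacian setT u v -> ip m v u <= 0.
Proof.
move=> [[psi [tpsi psi_u /choice[w psi_w]]] uv].
have uL : (u : Rn R N -> R) \in Lfun m 2%:R%:E by exact: L2_Lfun2.
have vL : (v : Rn R N -> R) \in Lfun m 2%:R%:E by exact: L2_Lfun2.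
have wL i : (w i : Rn R N -> R) \in Lfun m 2%:R%:E by exact: L2_Lfun2.
have pL n s : partial s (psi n) \in Lfun m 2%:R%:E by exact: test_function_Lfun2.
(* The two limits are taken one after the other: here [n] is fixed, so that the Laplacian stays on
   [psi n], and k tends to infinity in the approximation of [u]; [n] tends to infinity
   afterwards. *)
have E n : ip m v (psi n) = - \sum_i ip m (w i) (partial [:: i] (psi n)).
  rewrite -[LHS](uv _ (tpsi n)) -/(ip m u (laplacian (psi n))).
  have c1 : ip m (psi k) (laplacian (psi n)) @[k --> \oo] --> ip m u (laplacian
    (psi n)).
    by apply: ip_cvg => // [k|]; [exact: (pL k [::])|exact: laplacian_Lfun2].
  have c2 : ip m (psi k) (laplacian (psi n)) @[k --> \oo] -->
      - \sum_i ip m (w i) (partial [:: i] (psi n)).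
    rewrite (_ : (fun k => _) = fun k =>
      - \sum_i ip m (partial [:: i] (psi k)) (partial [:: i] (psi n))).
      apply: cvgN; apply: cvg_big => [|i _]; [exact: add_continuous|exact: ip_cvg].
    apply/funext => k; rewrite ipC laplacianE ip_sum//; last exact: (pL k [::]).
    by rewrite -sumrN; apply: eq_bigr => i _; rewrite ipC ip_partial.
  exact: (cvg_unique _ c1 c2).
have c1 : ip m v (psi n) @[n --> \oo] --> ip m v u.
  rewrite ipC (_ : (fun n => _) = fun n => ip m (psi n) v);
    last by apply/funext => n; rewrite ipC.
  by apply: ip_cvg => // n; exact: (pL n [::]).
have c2 : ip m v (psi n) @[n --> \oo] --> - \sum_i ip m (w i) (w i).
  rewrite (_ : (fun n => _) = fun n => - \sum_i ip m (partial [:: i] (psi n)) (w i)).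
    apply: cvgN; apply: cvg_big => [|i _]; [exact: add_continuous|exact: ip_cvg].
  by apply/funext => n; rewrite E; congr (- _); apply: eq_bigr => i _; rewrite ipC.
rewrite (cvg_unique _ c1 c2) // oppr_le0; apply: sumr_ge0 => i _.
by rewrite ip_self// sqr_ge0.
Qed.

Lemma dirichlet_dissipative (mu h : R) (u v : L2 m) : 0 <= mu -> 0 <= h ->
  dirichlet_laplacian setT u (v + mu *: u) -> (1 + h * mu) * `|u| <= `|u - h *: v|.
Proof.
move=> mu0 h0 /dirichlet_ip_le0 uv.
have c0 : 0 < 1 + h * mu by rewrite ltr_pwDl// mulr_ge0.
(* The step h / (1 + h mu) comes from u - h v = (1 + h mu) (u - h / (1 + h mu) w), where w = v + mu
   u is the Laplacian of u. *)
have := norm_le_of_ip_le0 (divr_ge0 h0 (ltW c0)) uv.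
rewrite -(ler_pM2l c0) => /le_trans; apply.
rewrite -{1}(gtr0_norm c0) -normrZ scalerBr scalerA mulrCA mulfV ?gt_eqF// mulr1.
by rewrite scalerDr scalerDl scale1r scalerA opprD addrACA subrr addr0.
Qed.

End dirichlet_dissipative.

(** * Riemann integrals *)

Section riemann.
Context (R : realType) (X : normedModType R).
Implicit Types (h : R -> X) (a b : R) (l : X).

Definition partition_mesh a b delta (n : nat) (p : nat -> R) : Prop :=
  [/\ p 0%N = a, p n = b & forall i, (i < n)%N ->
      [/\ a <= p i, p i <= p i.+1, p i.+1 <= b & p i.+1 - p i < delta]].

Lemma partition_mesh_exists a b delta : a <= b -> 0 < delta ->
  exists n p, partition_mesh a b delta n p.
Proof.
move=> ab d0; pose n := (Num.truncn ((b - a) / delta)).+1.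
have n0 : 0 < n%:R :> R by rewrite ltr0n.
have nd : (b - a) / n%:R < delta by rewrite ltr_pdivrMr// mulrC -ltr_pdivrMr//
  truncnS_gt.
have c0 : 0 <= (b - a) / n%:R by rewrite divr_ge0 ?subr_ge0// ltW.
exists n, (fun i => a + i%:R * ((b - a) / n%:R)); split; first by rewrite mul0r addr0.
  by rewrite mulrC mulfVK ?gt_eqF// addrC subrK.
move=> i ni; have E : a + i.+1%:R * ((b - a) / n%:R) - (a + i%:R * ((b - a) /
  n%:R)) = (b - a) / n%:R.
  by rewrite opprD addrACA subrr add0r -mulrBl -natrB// subSnn mul1r.
split; rewrite ?E//.
- by rewrite lerDl mulr_ge0.
- by rewrite -subr_ge0 E.
- by rewrite -lerBrDl mulrC -mulrA ler_piMr ?subr_ge0// mulrC ler_pdivrMr//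
  mul1r ler_nat.
Qed.

Lemma riemann_left_sum h a b l e : riemann_integral h a b l -> 0 < e ->
  exists2 delta, 0 < delta & forall n p, partition_mesh a b delta n p ->
    `|\sum_(i < n) (p i.+1 - p i) *: h (p i) - l| < e.
Proof.
move=> hl /hl[d d0 Hd]; exists d => // n p [p0 pn Hp].
by apply: Hd => // i /Hp[_ pp _ pd]; split.
Qed.

Lemma riemann_tag_in a b n (p xi : nat -> R) : p 0%N = a -> p n = b ->
  (forall i, (i < n)%N -> p i <= xi i /\ xi i <= p i.+1) ->
  forall i, (i < n)%N -> a <= xi i <= b.
Proof.
move=> p0 pn px i ni.
have mono j k : (j <= k <= n)%N -> p j <= p k.
  elim: k => [|k IH]; first by rewrite leqn0 => /andP[/eqP ->].
  rewrite leq_eqVlt => /andP[/orP[/eqP ->//|jk] kn].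
  have [pk kp] := px k kn.
  by apply: le_trans (IH _) (le_trans pk kp); rewrite -ltnS jk ltnW.
have [pxi xip] := px i ni.
by rewrite -p0 -pn (le_trans (mono _ _ _) pxi) ?(le_trans xip (mono _ _
  _)) ?leq0n ?leqnn ?(ltnW ni) ?ni.
Qed.

Lemma eq_riemann_integral h1 h2 a b l : (forall s, a <= s <= b -> h1 s = h2 s) ->
  riemann_integral h1 a b l -> riemann_integral h2 a b l.
Proof.
move=> h12 hl e /hl[d d0 Hd]; exists d => // n p xi p0 pn px.
rewrite (eq_bigr (fun i : 'I_n => (p i.+1 - p i) *: h1 (xi i))); first exact: Hd.
move=> i _; rewrite h12//; apply: (riemann_tag_in p0 pn _ (ltn_ord i)) => j /px[]//.
Qed.

Lemma riemann_integralB h1 h2 a b l1 l2 :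
  riemann_integral h1 a b l1 -> riemann_integral h2 a b l2 ->
  riemann_integral (h1 \- h2) a b (l1 - l2).
Proof.
move=> hl1 hl2 e e0; have e2 : 0 < e / 2 by rewrite divr_gt0.
have [d1 d10 Hd1] := hl1 _ e2; have [d2 d20 Hd2] := hl2 _ e2.
exists (Num.min d1 d2); first by rewrite lt_min d10.
move=> n p xi p0 pn px; under eq_bigr do rewrite scalerBr.
rewrite sumrB; set A := \sum_(i < n) _; set B := \sum_(i < n) _.
have -> : A - B - (l1 - l2) = (A - l1) - (B - l2).
  by rewrite !opprB -!addrA; congr (_ + _); rewrite addrCA [RHS]addrCA [- l1 - B]addrC.
apply: le_lt_trans (ler_normB _ _) _; rewrite [ltRHS]splitr ltrD//.
  by apply: Hd1 => // i /px[? ?]; rewrite lt_min => /andP[].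
by apply: Hd2 => // i /px[? ?]; rewrite lt_min => /andP[].
Qed.

Lemma riemann_integral_cst (x : X) a b : riemann_integral (fun=> x) a b ((b - a) *: x).
Proof.
move=> e e0; exists 1 => // n p xi p0 pn _.
rewrite -scaler_suml -(big_mkord xpredT (fun i => p i.+1 - p i)).
by rewrite telescope_sumr// p0 pn subrr normr0.
Qed.

(** [G] stands in for a primitive of [g]: the last hypothesis compares its increments with left
    rectangles, so the norms of the left sums are bounded by a telescoping sum. *)
Lemma riemann_integral_bound h (g G : R -> R) a b l : a <= b ->
  riemann_integral h a b l -> (forall s, a <= s <= b -> `|h s| <= g s) ->
  (forall s r, a <= s -> s <= r -> r <= b -> (r - s) * g s <= G r - G s) ->
  `|l| <= G b - G a.
Proof.
move=> ab hl hg gG; apply/ler_addgt0Pr => e e0.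
have [d d0 Hd] := riemann_left_sum hl e0.
have [n [p Pp]] := partition_mesh_exists ab d0.
have := Hd _ _ Pp; move: Pp => [p0 pn Hp] He.
rewrite -[l](subrK (\sum_(i < n) (p i.+1 - p i) *: h (p i))) addrC.
apply: le_trans (ler_normD _ _) _; apply: lerD; last by rewrite distrC ltW.
apply: le_trans (ler_norm_sum _ _ _) _.
rewrite -p0 -pn -(telescope_sumr (G \o p) (leq0n n)) big_mkord; apply: ler_sum => i _.
have [api pii pib _] := Hp i (ltn_ord i).
rewrite normrZ ger0_norm ?subr_ge0//; apply: le_trans (gG _ _ api pii pib).
by rewrite ler_wpM2l ?subr_ge0// hg// api (le_trans pii).
Qed.

Lemma riemann_integral_unique h a b l1 l2 : a <= b ->
  riemann_integral h a b l1 -> riemann_integral h a b l2 -> l1 = l2.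
Proof.
move=> ab hl1 hl2; apply/eqP; rewrite -subr_eq0 -normr_le0.
have := riemann_integral_bound (g := fun=> 0) (G :=
  fun=> 0) ab (riemann_integralB hl1 hl2).
rewrite subrr; apply => [s _|s r _ _ _]; first by rewrite /= subrr normr0.
by rewrite mulr0.
Qed.

(** All three integrals are given. Partitions of the two halves, fine enough also for the whole
    interval, are joined at [b] and the left sums compared. *)
Lemma riemann_integral_cat h1 h2 h a b c l1 l2 l : a <= b -> b <= c ->
  riemann_integral h1 a b l1 -> riemann_integral h2 b c l2 ->
    riemann_integral h a c l ->
  (forall s, a <= s <= b -> h s = h1 s) -> (forall s, b <= s <= c -> h s = h2 s) ->
  l = l1 + l2.
Proof.
move=> ab bc hl1 hl2 hl hh1 hh2.
apply/eqP; rewrite eq_sym -subr_eq0 -normr_le0; apply/ler_addgt0Pr => e e0;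
  rewrite add0r.
have e3 : 0 < e / 2 / 2 by rewrite !divr_gt0.
have [d1 d10 Hd1] := riemann_left_sum hl1 e3.
have [d2 d20 Hd2] := riemann_left_sum hl2 e3.
have e2 : 0 < e / 2 by rewrite divr_gt0.
have [d d0 Hd] := riemann_left_sum hl e2.
have m1 : 0 < Num.min d1 d by rewrite lt_min d10.
have m2 : 0 < Num.min d2 d by rewrite lt_min d20.
have [n1 [p1 [p10 p1n Hp1]]] := partition_mesh_exists ab m1.
have [n2 [p2 [p20 p2n Hp2]]] := partition_mesh_exists bc m2.
pose p i := if (i <= n1)%N then p1 i else p2 (i - n1)%N.
have pl i : (i <= n1)%N -> p i = p1 i by rewrite /p => ->.
have pr i : p (n1 + i)%N = p2 i.
  by rewrite /p addKn; case: i => [|i];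
    rewrite ?addn0 ?leqnn ?p1n ?p20// addnS ltnNge leq_addr.
have {}Hd1 : `|\sum_(i < n1) (p1 i.+1 - p1 i) *: h1 (p1 i) - l1| < e / 2 / 2.
  by apply: Hd1; split => // i /Hp1[? ? ?]; rewrite lt_min => /andP[].
have {}Hd2 : `|\sum_(i < n2) (p2 i.+1 - p2 i) *: h2 (p2 i) - l2| < e / 2 / 2.
  by apply: Hd2; split => // i /Hp2[? ? ?]; rewrite lt_min => /andP[].
have : `|\sum_(i < n1 + n2) (p i.+1 - p i) *: h (p i) - l| < e / 2.
  apply: Hd; split; [by rewrite pl|by rewrite pr|] => i ni.
  have [ni1|ni1] := ltnP i n1.
    rewrite !pl// ?(ltnW ni1)//; have [? ? pb] := Hp1 i ni1.
    by rewrite lt_min => /andP[_ ?]; split => //; exact: le_trans bc.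
  have := Hp2 (i - n1)%N; rewrite ltn_subLR// => /(_ ni).
  move=> -[bp ? ?]; rewrite lt_min => /andP[_ ?].
  by rewrite -(subnKC ni1) -addnS !pr; split => //; exact: le_trans bp.
rewrite big_split_ord /=.
rewrite [X in `|X + _ - _|](_ : _ = \sum_(i < n1) (p1 i.+1 - p1 i) *: h1 (p1 i));
  last first.
  apply: eq_bigr => i _; rewrite !pl ?(ltnW (ltn_ord i))// hh1//.
  by have [-> ? ? _] := Hp1 i (ltn_ord i); rewrite (le_trans _ (_ : p1 i.+1 <= b)).
rewrite [X in `|_ + X - _|](_ : _ = \sum_(i < n2) (p2 i.+1 - p2 i) *: h2 (p2 i));
  last first.
  apply: eq_bigr => i _; rewrite -addnS !pr hh2//.
  by have [-> ? ? _] := Hp2 i (ltn_ord i); rewrite (le_trans _ (_ : p2 i.+1 <= c)).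
move: Hd1 Hd2; set A := \sum_(i < n1) _; set B := \sum_(i < n2) _ => HA HB HAB.
have -> : l1 + l2 - l = (A + B - l) - ((A - l1) + (B - l2)).
  rewrite opprD !opprB [l1 - A + _]addrACA -[- A - B]opprD.
  by rewrite addrCA [A + B - l + _]addrAC subrr add0r addrC.
apply: ltW; apply: le_lt_trans (ler_normB _ _) _.
rewrite [ltRHS]splitr ltrD// [ltRHS]splitr.
by apply: le_lt_trans (ler_normD _ _) _; rewrite ltrD.
Qed.

End riemann.

(** * Differential inequalities with one-sided difference quotients *)

Section dini.
Context (R : realType).

Lemma within_continuous_dist (X : normedModType R) (A : set R) (u : R -> X) t e :
  {within A, continuous u} -> A t -> 0 < e ->
  exists2 d, 0 < d & forall s, A s -> `|s - t| < d -> `|u s - u t| < e.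
Proof.
move=> /subspace_continuousP cu At e0.
have /cvgrPdist_lt/(_ _ e0) := cu t At.
rewrite near_withinE => /nbhs_ballP[d /= d0 Hd]; exists d => // s As st.
by rewrite distrC; apply: Hd => //; rewrite /ball /= distrC.
Qed.

(** For each slope e > 0 the bound c r <= c 0 + e r propagates: by continuity it reaches the
    supremum m of the times up to which it holds, and the hypothesis at m carries it further unless
    m = T. *)
Lemma dini_nonincreasing (c : R -> R) (T : R) : 0 <= T ->
  {within `[0, T], continuous c} ->
  (forall t e, 0 <= t < T -> 0 < e ->
    exists2 d, 0 < d & forall h, 0 < h < d -> c (t + h) <= c t + h * e) ->
  c T <= c 0.
Proof.
move=> T0 cc Hc; apply/ler_addgt0Pr => e' e'0.
(* Makes e T at most e', also when T = 0. *)
pose e := e' / (T + 1).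
have e0 : 0 < e by rewrite divr_gt0// ltr_wpDl.
apply: (@le_trans _ _ (c 0 + e * T)); last first.
  by rewrite lerD2l mulrAC ler_pdivrMr ?ltr_wpDl// ler_pM2l// lerDl.
pose E := [set s | 0 <= s <= T /\ forall r, 0 <= r <= s -> c r <= c 0 + e * r].
have E0 : E 0.
  by split; [rewrite lexx|move=> r; rewrite -eq_le => /eqP <-; rewrite mulr0 addr0].
have supE : has_sup E by split; [exists 0|exists T; move=> s [/andP[]]].
pose m := sup E.
have m0 : 0 <= m by exact: (sup_upper_bound supE).
have mT : m <= T by apply: ge_sup; [exists 0|move=> s [/andP[]]].
have ltm r : 0 <= r < m -> c r <= c 0 + e * r.
  move=> /andP[r0 rm]; have mr : 0 < m - r by rewrite subr_gt0.
  have [s [_ Es] rs] := sup_adherent mr supE.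
  by apply: Es; rewrite r0 ltW//; move: rs; rewrite -/m opprB addrC subrK.
have Em : c m <= c 0 + e * m.
  move: m0; rewrite le_eqVlt => /orP[/eqP <-|m0]; first by rewrite mulr0 addr0.
  apply/ler_addgt0Pr => f f0.
  have mI : `[0, T]%classic m by rewrite /= in_itv /= ltW.
  have [d d0 Hd] := within_continuous_dist cc mI f0.
  pose s := Num.max 0 (m - d / 2).
  have sm : s < m by rewrite gt_max m0 ltrBlDr ltrDl divr_gt0.
  have s0 : 0 <= s by rewrite le_max lexx.
  have : `|c s - c m| < f.
    apply: Hd; first by rewrite /= in_itv /= s0 (le_trans (ltW sm)).
    rewrite distrC gtr0_norm ?subr_gt0// ltrBlDr -ltrBlDl.
    by rewrite lt_max ltrD2l ltrN2 ltr_pdivrMr// ltr_pMr// ltr1n orbT.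
  rewrite ltr_distlC => /andP[_ /ltW cm]; apply: le_trans cm _.
  rewrite lerD2r (le_trans (ltm _ _)) ?s0//.
  by rewrite lerD2l ler_pM2l// ltW.
have [mltT|] := ltP m T; last first.
  by move=> Tm; rewrite -(_ : m = T)//; apply/eqP; rewrite eq_le mT.
have [|d d0 Hd] := Hc m e _ e0; first by rewrite m0.
pose h := Num.min (d / 2) (T - m).
have h0 : 0 < h by rewrite lt_min divr_gt0//= subr_gt0.
have hd : h < d by rewrite gt_min ltr_pdivrMr// ltr_pMr// ltr1n.
suff : E (m + h) by move=> /(sup_upper_bound supE); rewrite -/m gerDl leNgt h0.
split.
  by rewrite (addr_ge0 m0 (ltW h0))/= -lerBrDl ge_min lexx orbT.
move=> r /andP[r0 rmh]; have [rm|] := ltP r m; first by apply: ltm; rewrite r0.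
rewrite le_eqVlt => /orP[/eqP <-//|mr].
have := Hd (r - m); rewrite subr_gt0 mr ltrBlDl (le_lt_trans rmh) ?ltrD2l//.
rewrite addrC subrK => /(_ isT) /le_trans; apply.
apply: le_trans (lerD Em (lexx _)) _.
by rewrite -addrA [_ * e]mulrC -mulrDr [m + _]addrC subrK.
Qed.

(** The hypothesis is what dissipativity yields for an implicit Euler step. It makes the upper right
    Dini derivative of exp (mu t) n t at most 0, since exp y and 1 + y differ to second order
    only. *)
Lemma dini_exp_decay (n : R -> R) (mu T : R) : 0 <= mu -> 0 <= T ->
  (forall t, 0 <= n t) -> {within `[0, T], continuous n} ->
  (forall t e, 0 <= t < T -> 0 < e -> exists2 d, 0 < d &
    forall h, 0 < h < d -> (1 + h * mu) * n (t + h) <= n t + h * e) ->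
  n T <= expR (- (mu * T)) * n 0.
Proof.
move=> mu0 T0 n0 cn Hn; pose c t := expR (mu * t) * n t.
suff : c T <= c 0.
  by rewrite /c mulr0 expR0 mul1r => H;
    rewrite expRN mulrC ler_pdivlMr ?expR_gt0// mulrC.
apply: dini_nonincreasing => //.
  have ce : {within `[0, T], continuous (fun t => expR (mu * t))}.
    apply: continuous_subspaceT => t; apply: continuous_comp;
      last exact: continuous_expR.
    by apply: cvgMr; exact: cvg_id.
  by move=> t; apply: cvgM; [exact: ce|exact: cn].
move=> t e tT e0; pose k := expR (mu * t).
have k0 : 0 < k by exact: expR_gt0.
have [|d d0 Hd] := Hn t (e / (4 * k)) tT; first by rewrite divr_gt0// mulr_gt0.
pose A := k * n t.
have A0 : 0 <= A by rewrite mulr_ge0// ltW.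
(* For h < 1 / q the second-order terms in h are absorbed by h * e. *)
pose q := 4 * mu ^+ 2 * A / e + 2 * mu + 1.
have q1 : 0 <= 4 * mu ^+ 2 * A / e by rewrite divr_ge0 ?mulr_ge0 ?sqr_ge0// ltW.
have q2 : 0 <= 2 * mu by rewrite mulr_ge0.
have q0 : 0 < q by rewrite /q; move: q1 q2; lra.
exists (Num.min d q^-1); first by rewrite lt_min d0 invr_gt0.
move=> h /andP[h0]; rewrite lt_min => /andP[hd hq].
have {}Hd := Hd h; rewrite h0 hd in Hd; have {}Hd := Hd isT.
have hq1 : h * q < 1 by rewrite -ltr_pdivlMr// mul1r.
pose y := h * mu.
have y0 : 0 <= y by rewrite mulr_ge0// ltW.
have hr r : 0 <= r -> r <= q -> h * r <= 1.
  by move=> r0 rq; apply: le_trans (ltW hq1); rewrite ler_pM2l.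
have y2 : 2 * y <= 1.
  by have := hr (2 * mu); rewrite /y /q; move: q1 q2; lra.
have yA : 4 * (y ^+ 2 * A) <= h * e.
  have H : h * (4 * mu ^+ 2 * A) <= e.
    have : h * (4 * mu ^+ 2 * A / e) <= 1.
      by apply: hr q1 _; rewrite /q -addrA lerDl addr_ge0.
    by rewrite [h * _]mulrA ler_pdivrMr// mul1r.
  have -> : 4 * (y ^+ 2 * A) = h * (h * (4 * mu ^+ 2 * A)) by rewrite /y; ring.
  by rewrite ler_pM2l.
have Ey : expR y * (1 - y) <= 1.
  by rewrite mulrC -ler_pdivlMr ?expR_gt0// mul1r -expRN expR_ge1Dx.
(* As 1 - y^2 = (1 - y)(1 + y), the factor 1 - y absorbs exp y, while 1 + y is the one in the
   hypothesis. *)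
have ct : c (t + h) * (1 - y ^+ 2) <= A + h * e / 4.
  have -> : c (t + h) * (1 - y ^+ 2) = (expR y * (1 - y)) * (k * ((1 + y) * n (t + h))).
    by rewrite /c [mu * (t + h)]mulrDr expRD -/k [mu * h]mulrC -/y; ring.
  apply: (@le_trans _ _ (1 * (k * ((1 + y) * n (t + h))))).
    by rewrite ler_wpM2r// mulr_ge0 ?(ltW k0)// mulr_ge0 ?n0// addr_ge0.
  rewrite mul1r; apply: (@le_trans _ _ (k * (n t + h * (e / (4 * k)))));
    first by rewrite ler_pM2l.
  rewrite mulrDr lerD2l le_eqVlt; apply/orP; left; apply/eqP; field.
  by rewrite gt_eqF.
have he : 0 < h * e by rewrite mulr_gt0.
have y22 : 4 * y ^+ 2 <= 1 by nra.
rewrite -[leRHS]/(A + h * e).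
have y1 : 0 < 1 - y ^+ 2 by lra.
rewrite -(ler_pM2r y1); apply: le_trans ct _; nra.
Qed.

End dini.

(** * Histories from continuous functions; linearity of the semigroup *)

Section hist_of_fun.
Context (R : realType) (X : normedModType R) (tau : R).

Fact hist_of_fun_subproof (u : R -> X) : continuous u ->
  (fun t => if t \in `[- tau, 0] then u t else 0) \in @hist_pred R X tau.
Proof.
move=> cu; apply/asboolP; split; last by move=> t /negbTE ->.
apply: (@subspace_eq_continuous _ _ _ u); last exact: continuous_subspaceT.
by move=> t; rewrite inE /from_subspace /= => ->.
Qed.

Definition hist_of_fun (u : R -> X) (cu : continuous u) : hist X tau :=
  Hist (hist_of_fun_subproof cu).

Lemma hist_of_funE (u : R -> X) (cu : continuous u) t : t \in `[- tau, 0] ->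
  hist_of_fun cu t = u t.
Proof. by rewrite /= => ->. Qed.

Definition hist_cst (x : X) : hist X tau := hist_of_fun (fun=> cvg_cst x).

End hist_of_fun.

Section C0_linear.
Context (R : realType) (X : normedModType R) (S : R -> X -> X).
Hypothesis CS : C0_semigroup S.

Lemma C0D t x y : 0 <= t -> S t (x + y) = S t x + S t y.
Proof. by move=> t0; have := C0_linear CS t0 1 x y; rewrite /= !scale1r. Qed.

Lemma C00 t : 0 <= t -> S t 0 = 0.
Proof. by move=> t0; apply: (addrI (S t 0)); rewrite -C0D// !addr0. Qed.

Lemma C0Z t a x : 0 <= t -> S t (a *: x) = a *: S t x.
Proof. by move=> t0; have := C0_linear CS t0 a x 0; rewrite /= !addr0 C00// addr0. Qed.

Lemma C0B t x y : 0 <= t -> S t (x - y) = S t x - S t y.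
Proof. by move=> t0; rewrite C0D// -scaleN1r C0Z// scaleN1r. Qed.

Lemma C0_sum t (n : nat) (x : 'I_n -> X) : 0 <= t ->
  S t (\sum_i x i) = \sum_i S t (x i).
Proof.
move=> t0; elim: n x => [|n IH] x; first by rewrite !big_ord0 C00.
by rewrite !big_ord_recl C0D// IH.
Qed.

Lemma C0_riemann_integral t a b (h : R -> X) l : 0 <= t ->
  riemann_integral h a b l -> riemann_integral (fun s => S t (h s)) a b (S t l).
Proof.
move=> t0 hl e e0.
have /cvgrPdist_lt/(_ _ e0)/nbhs_ballP[d /= d0 Hd] := C0_continuous CS t0 (x := l).
have [d' d'0 Hd'] := hl _ d0; exists d' => // n p xi p0 pn px.
under eq_bigr do rewrite -C0Z//.
by rewrite -C0_sum// distrC; apply: Hd; rewrite -ball_normE /= distrC Hd'.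
Qed.

End C0_linear.

(** * Exponential decay of the semigroup *)

Section semigroup_decay.
Context (R : realType) (X : normedModType R) (S : R -> X -> X).
Variables (sigma : R) (F : X -> X) (tau mu : R).
Hypotheses (tau0 : 0 < tau) (mu0 : 0 <= mu) (CS : C0_semigroup S).
Hypothesis sol : forall phi : hist X tau, exists u, mild_solution S sigma F phi u.
Hypothesis diss : forall x y h, 0 <= h -> generator S x y ->
  (1 + h * mu) * `|x| <= `|x - h *: y|.

(* The history vanishing on [-tau, -tau/2] with value x at 0: up to tau/2 the
   delayed terms do not see x, so that the solution is S(t)x plus a term
   independent of x. *)
Let ramp x t : X := Num.max 0 (1 + 2 * t / tau) *: x.

Let ramp_continuous x : continuous (ramp x).
Proof.
move=> t; apply: (@cvgZr_tmp _ _ _ _ _ (fun t => Num.max 0 (1 + 2 * t / tau))).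
apply: (@continuous_max R R (fun=> 0) (fun t => 1 + 2 * t / tau)); first exact: cvg_cst.
by apply: cvgD; [exact: cvg_cst|apply: cvgMr_tmp; apply: cvgMl_tmp; exact: cvg_id].
Qed.

(** Since [F 0] may differ from 0, the solution from the zero history is subtracted: up to time
    tau/2 both solutions have the same Duhamel integrals. *)
Lemma C0_orbit_eq_sub_solutions x : exists u v : R -> X,
  [/\ {within `[- tau, +oo[, continuous u}, {within `[- tau, +oo[, continuous v} &
      forall t, 0 <= t <= tau / 2 -> S t x = u t - v t].
Proof.
pose phi := hist_of_fun tau (ramp_continuous (x := x)).
have [u uP] := sol phi; have [v vP] := sol 0.
exists u, v; split; [exact: mild_continuous uP|exact: mild_continuous vP|].
move=> t /andP[t0 tt].
have phi0 : phi 0 = x.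
  rewrite hist_of_funE ?in_itv /= ?oppr_le0 ?lexx ?ltW//.
  by rewrite /ramp mulr0 mul0r addr0 max_r// scale1r.
have I0 : 0 \in `[- tau, 0] by rewrite in_itv /= oppr_le0 lexx ltW.
move: t0; rewrite le_eqVlt => /orP[/eqP <-|t0].
  by rewrite (mild_initial uP)// (mild_initial vP)// phi0 (C0_id CS) subr0.
have [I1 [I2 [hI1 hI2 ->]]] := mild_duhamel uP t0.
have [J1 [J2 [hJ1 hJ2 ->]]] := mild_duhamel vP t0.
have uv s : 0 <= s <= t -> u (s - tau) = 0 /\ v (s - tau) = 0.
  move=> /andP[s0 st].
  have s2 : s <= tau / 2 := le_trans st tt.
  have sI : s - tau \in `[- tau, 0].
    by rewrite in_itv /= lerDr s0 subr_le0 (le_trans s2)//; move: tau0; lra.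
  rewrite (mild_initial uP)// (mild_initial vP)// hist_of_funE//; split => //.
  rewrite /ramp max_l ?scale0r// -mulrA mulrBl mulfV ?gt_eqF// mulrBr mulr1.
  suff : 2 * (s / tau) <= 1 by lra.
  by rewrite mulrA ler_pdivrMr// mul1r mulrC -ler_pdivlMr.
have <- : I1 = J1.
  apply: (riemann_integral_unique (ltW t0) hI1);
    apply: eq_riemann_integral hJ1 => s /uv[-> ->] //.
have <- : I2 = J2.
  apply: (riemann_integral_unique (ltW t0) hI2);
    apply: eq_riemann_integral hJ2 => s /uv[-> ->] //.
by rewrite phi0 (_ : (0 : hist X tau) 0 = 0)//
  (C00 CS (ltW t0)) add0r -(addrA (S t x)) addrK.
Qed.

(** Left continuity at positive times is not immediate from [C0_strong]; it is inherited from the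
    mild solutions. *)
Lemma C0_orbit_continuous x : {within `[0, tau / 2], continuous (fun t => S t x)}.
Proof.
have [u [v [cu cv E]]] := C0_orbit_eq_sub_solutions x.
apply: (@subspace_eq_continuous _ _ _ (fun t => u t - v t)).
  by move=> t; rewrite inE /from_subspace /= in_itv /= => /E.
have sub : `[0, tau / 2]%classic `<=` `[- tau, +oo[%classic.
  by move=> t /=; rewrite !in_itv /= andbT => /andP[t0 _]; apply: le_trans t0;
    rewrite oppr_le0 ltW.
by move=> t; apply: cvgB; [exact: (continuous_subspaceW sub cu)|exact:
  (continuous_subspaceW sub cv)].
Qed.

(** With the constant history x, Duhamel's first integral up to a time t <= tau sees only the
    history and is the integral wanted. *)
Lemma C0_orbit_integral x t : 0 < t <= tau ->
  exists I, riemann_integral (fun s => S (t - s) x) 0 t I.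
Proof.
move=> /andP[t0 tt]; have [u uP] := sol (hist_cst tau x).
have [I1 [_ [hI1 _ _]]] := mild_duhamel uP t0; exists I1.
apply: eq_riemann_integral hI1 => s /andP[s0 st]; congr (S _ _).
have sI : s - tau \in `[- tau, 0] by rewrite in_itv /= lerDr s0 subr_le0 (le_trans st).
by rewrite (mild_initial uP)// hist_of_funE.
Qed.

(** The integral of the orbit of x over [0, t]; the default 0 can occur only outside the range
    covered by [IP]. *)
Let I x t : X := if pselect (exists I, riemann_integral (fun s =>
  S (t - s) x) 0 t I) is left H
  then projT1 (cid H) else 0.

Let IP x t : 0 < t <= tau -> riemann_integral (fun s => S (t - s) x) 0 t (I x t).
Proof.
move=> /C0_orbit_integral => /(_ x) H; rewrite /I; case: pselect => // H'.
exact: (projT2 (cid H')).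
Qed.

(** Split at t: on [0, t] the factor [S s] comes out of the integral, and on [t, s + t] the
    integrand is a translate of that of [I x s]. *)
Let ID x s t : 0 < s -> 0 < t -> s + t <= tau -> I x (s + t) = S s (I x t) + I x s.
Proof.
move=> s0 t0 st.
have sI : 0 < s <= tau by rewrite s0 (le_trans _ st)// lerDl ltW.
have tI : 0 < t <= tau by rewrite t0 (le_trans _ st)// lerDr ltW.
have stI : 0 < s + t <= tau by rewrite addr_gt0.
have H2 : riemann_integral (fun r => S (s - (r - t)) x) t (s + t) (I x s).
  move=> e /(IP x sI)[d d0 Hd]; exists d => // n p xi p0 pn px.
  have := Hd n (fun i => p i - t) (fun i => xi i - t).
  rewrite p0 pn subrr addrK => /(_ erefl erefl) H.
  rewrite (eq_bigr (fun i : 'I_n => (p i.+1 - t - (p i - t)) *: S (s - (xi i - t)) x)).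
    apply: H => i /px[? ? ?]; rewrite !lerD2r; split => //.
    by rewrite opprB addrA subrK.
  by move=> i _; congr (_ *: _); rewrite opprB addrA subrK.
apply: (riemann_integral_cat (ltW t0) _
  (C0_riemann_integral CS (ltW s0) (IP x tI)) H2 (IP x stI)).
- by rewrite lerDr ltW.
- by move=> r /andP[r0 rt]; rewrite -(C0_add CS) ?subr_ge0 ?(ltW s0)// addrA.
- by move=> r _; rewrite opprB addrA.
Qed.

(** Together with [generator_I] this makes the domain of the generator dense. *)
Let I_cvg x : h^-1 *: I x h @[h --> 0^'+] --> x.
Proof.
apply/cvgrPdist_le => e e0.
have /cvgrPdist_lt/(_ _ e0) := C0_strong CS (x := x).
rewrite near_withinE => /nbhs_ballP[d /= d0 Hd].
near=> h.
have h0 : 0 < h by [].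
have ht : h <= tau by near: h; exact: nbhs_right_le.
have hd : h < d by near: h; exact: nbhs_right_lt.
have hI : 0 < h <= tau by rewrite h0.
have := riemann_integral_bound (g := fun=> e) (G := fun r => r * e) (ltW h0)
  (riemann_integralB (riemann_integral_cst x 0 h) (IP x hI)).
rewrite subr0 mul0r subr0 => H.
rewrite -[x in `|x - _|](scalerK (a :=
  h)) ?gt_eqF// -scalerBr normrZ gtr0_norm ?invr_gt0//.
rewrite ler_pdivrMl//; apply: H => [s /andP[s0 sh]|s r _ sr _]; last by rewrite -mulrBl.
rewrite /=; have := subr_ge0 s h; rewrite sh le_eqVlt => /orP[/eqP <-|hs].
  by rewrite (C0_id CS) subrr normr0 ltW.
apply/ltW/Hd => //; rewrite /ball /= sub0r normrN gtr0_norm//.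
by rewrite (le_lt_trans _ hd)// gerBl.
Unshelve. all: by end_near. Qed.

(** By [ID], used with its two times in either order, S h (I x t) - I x t equals S t (I x h) - I x
    h, whose quotient by h tends to S t x - x by [I_cvg]. *)
Let generator_I x t : 0 < t < tau -> generator S (I x t) (S t x - x).
Proof.
move=> /andP[t0 tt]; rewrite /generator.
apply: (@cvg_trans _ ((S t (h^-1 *: I x h) - h^-1 *: I x h) @[h --> 0^'+])); last first.
  apply: cvgB; last exact: I_cvg.
  apply: (cvg_comp _ _ (I_cvg (x := x))); exact: (C0_continuous CS (ltW t0)).
apply: near_eq_cvg; near=> h.
have h0 : 0 < h by [].
have ht : h <= tau - t by near: h; apply: nbhs_right_le; rewrite subr_gt0.
rewrite C0Z ?(ltW t0)// -scalerBr; congr (_ *: _); apply/eqP.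
by rewrite subr_eq addrAC eq_sym subr_eq -!ID// ?[h + t]addrC// -lerBrDl.
Unshelve. all: by end_near. Qed.

(** Dissipativity is applied at the later time s + h, where the generator maps the orbit to S (s +
    h) y. Going back to time s costs o(h), because h^-1 (S h x - x) - S h y tends to y - y = 0. *)
Let decay_domain x y t : generator S x y -> 0 <= t <= tau / 2 ->
  `|S t x| <= expR (- (mu * t)) * `|x|.
Proof.
move=> xy /andP[t0 tt].
rewrite -{2}(C0_id CS x); apply: (dini_exp_decay (n := fun t => `|S t x|)) => //.
  have sub : `[0, t]%classic `<=` `[0, tau / 2]%classic.
    by move=> s /=; rewrite !in_itv /= => /andP[-> /le_trans]; apply.
  have cs : {within `[0, t], continuous (fun t => S t x)}.
    by apply: (continuous_subspaceW sub); exact: C0_orbit_continuous.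
  by move=> s; apply: cvg_norm; exact: cs.
move=> s e /andP[s0 st] e0.
have c : h^-1 *: (S h x - x) - S h y @[h --> 0^'+] --> (0 : X).
  by rewrite -(subrr y); apply: cvgB => //; exact: C0_strong.
have {}c : S s (h^-1 *: (S h x - x) - S h y) @[h --> 0^'+] --> (0 : X).
  rewrite -(C00 CS s0); apply: (cvg_comp _ _ c); exact: (C0_continuous CS s0).
have /cvgrPdist_lt/(_ _ e0) := c.
rewrite near_withinE => /nbhs_ballP[d /= d0 Hd]; exists d => // h /andP[h0 hd].
have := Hd h; rewrite /ball /= sub0r normrN gtr0_norm// => /(_ hd h0).
rewrite sub0r normrN => He.
have sh0 : 0 <= s + h by rewrite addr_ge0// ltW.
have gsh : generator S (S (s + h) x) (S (s + h) y).
  apply: (@cvg_trans _ (S (s + h) (k^-1 *: (S k x - x)) @[k --> 0^'+])); last first.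
    apply: (cvg_comp _ _ xy); exact: (C0_continuous CS sh0).
  apply: near_eq_cvg; near=> k; have k0 : 0 <= k by apply: ltW.
  by rewrite C0Z// C0B// -!(C0_add CS)// [k + _]addrC.
apply: le_trans (diss (ltW h0) gsh) _.
rewrite -C0Z// -C0B// (C0_add CS)// ?(ltW h0)//.
have -> : S h (x - h *: y) = x + h *: (h^-1 *: (S h x - x) - S h y).
  rewrite C0B ?C0Z ?(ltW h0)// scalerBr scalerA divff ?gt_eqF// scale1r.
  by rewrite addrA [x + _]addrC subrK.
rewrite C0D// C0Z//; apply: le_trans (ler_normD _ _) _.
by rewrite lerD2l normrZ gtr0_norm// ler_pM2l// ltW.
Unshelve. all: by end_near. Qed.

Lemma C0_decay_small x t : 0 <= t <= tau / 2 -> `|S t x| <= expR (- (mu * t)) * `|x|.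
Proof.
move=> /andP[t0 tt].
have c1 : `|S t (h^-1 *: I x h)| @[h --> 0^'+] --> `|S t x|.
  by apply: cvg_norm; apply: (cvg_comp _ _ (I_cvg (x := x)));
    exact: (C0_continuous CS t0).
have c2 : expR (- (mu * t)) * `|h^-1 *: I x h| @[h --> 0^'+] --> expR (- (mu *
  t)) * `|x|.
  by apply: cvgMl_tmp; apply: cvg_norm; exact: I_cvg.
apply: (ler_cvg_to c1 c2); near=> h.
have hI : 0 < h < tau by apply/andP; split => //; near: h; exact: nbhs_right_lt.
have h0 : 0 < h by case/andP: hI.
rewrite C0Z// !normrZ mulrCA ler_wpM2l//.
by apply: decay_domain (generator_I hI) _; rewrite t0.
Unshelve. all: by end_near. Qed.

Lemma C0_decay x t : 0 <= t -> `|S t x| <= expR (- (mu * t)) * `|x|.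
Proof.
move=> t0.
have iter s k y : 0 <= s <= tau / 2 ->
  `|S (k%:R * s) y| <= expR (- (mu * (k%:R * s))) * `|y|.
  move=> /andP[s0 st]; elim: k y => [|k IH] y.
    by rewrite mul0r (C0_id CS) mulr0 oppr0 expR0 mul1r.
  rewrite -addn1 natrD mulrDl mul1r (C0_add CS) ?mulr_ge0//.
  apply: le_trans (IH _) _.
  by rewrite mulrDr opprD expRD -mulrA ler_pM2l ?expR_gt0// C0_decay_small ?s0.
pose k := (Num.truncn (t / (tau / 2))).+1.
have k0 : 0 < k%:R :> R by rewrite ltr0n.
have := iter (t / k%:R) k x; rewrite [k%:R * _]mulrC divfK ?gt_eqF//; apply.
rewrite divr_ge0 ?(ltW k0)//= ler_pdivrMr// mulrC -ler_pdivrMr ?divr_gt0//.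
exact/ltW/truncnS_gt.
Qed.

End semigroup_decay.

(** * Contraction between two mild solutions *)

Lemma mild_solution_contraction (R : realType) (X : normedModType R) (S : R -> X -> X)
    (sigma : R) (F : X -> X) (tau mu L M : R) (phi psi : hist X tau) (u v : R ->
      X) (t : R) :
  C0_semigroup S -> 0 < mu -> 0 <= sigma -> 0 <= L -> 0 <= tau ->
  (forall x s, 0 <= s -> `|S s x| <= expR (- (mu * s)) * `|x|) ->
  (forall x y, `|F x - F y| <= L * `|x - y|) ->
  mild_solution S sigma F phi u -> mild_solution S sigma F psi v ->
  (forall s, - tau <= s -> `|u s - v s| <= M) -> 0 < t ->
  `|u t - v t| <= expR (- (mu * t)) * M + (sigma + L) * M / mu.
Proof.
move=> CS mu0 sigma0 L0 tau0 decay FL uP vP uvM t0.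
have M0 : 0 <= M by apply: le_trans (uvM 0 _); rewrite ?oppr_le0.
have [I1 [I2 [hI1 hI2 ->]]] := mild_duhamel uP t0.
have [J1 [J2 [hJ1 hJ2 ->]]] := mild_duhamel vP t0.
(* The kernel exp (- mu (t - s)) has integral at most 1 / mu. Its left rectangles are compared with
   the increments of exp (- mu (t - s)) / mu by means of 1 + x <= exp x. *)
have bd h B l : 0 <= B -> riemann_integral h 0 t l ->
    (forall s, 0 <= s <= t -> `|h s| <= expR (- (mu * (t - s))) * B) -> `|l| <= B / mu.
  move=> B0 hl hB.
  have -> : B / mu = expR (- (mu * (t - t))) * (B / mu) by rewrite subrr mulr0
    oppr0 expR0 mul1r.
  apply: le_trans (_ : _ <= expR (- (mu * (t - t))) * (B / mu) - expR (- (mu * (t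
    - 0))) * (B / mu)) _; last first.
    by rewrite gerBl mulr_ge0 ?expR_ge0// divr_ge0// ltW.
  apply: (riemann_integral_bound (G :=
    fun s => expR (- (mu * (t - s))) * (B / mu)) (ltW t0) hl hB).
  move=> s r s0 sr rt.
  have -> : expR (- (mu * (t - r))) = expR (- (mu * (t - s))) * expR (mu * (r - s)).
    by rewrite -expRD; congr expR; ring.
  set E := expR (- (mu * (t - s))); set q := expR _.
  have hq : mu * (r - s) <= q - 1 by rewrite lerBrDl expR_ge1Dx.
  have -> : E * q * (B / mu) - E * (B / mu) = E * (B / mu) * (q - 1) by ring.
  have -> : (r - s) * (E * B) = E * (B / mu) * (mu * (r - s)) by field; rewrite gt_eqF.
  by rewrite ler_wpM2l// mulr_ge0 ?expR_ge0// divr_ge0// ltW.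
have HS x s : 0 <= s <= t -> `|S (t - s) x| <= expR (- (mu * (t - s))) * `|x|.
  by move=> /andP[_ st]; apply: decay; rewrite subr_ge0.
have uvM' s : 0 <= s -> `|u (s - tau) - v (s - tau)| <= M.
  by move=> s0; apply: uvM; rewrite lerDr.
have H1 : `|I1 - J1| <= M / mu.
  apply: bd M0 (riemann_integralB hI1 hJ1) _ => s st.
  have /andP[s0 ts] := st.
  rewrite /= -(C0B CS) ?subr_ge0//; apply: le_trans (HS _ _ st) _.
  by rewrite ler_pM2l ?expR_gt0// uvM'.
have H2 : `|I2 - J2| <= L * M / mu.
  apply: bd (mulr_ge0 L0 M0) (riemann_integralB hI2 hJ2) _ => s st.
  have /andP[s0 ts] := st.
  rewrite /= -(C0B CS) ?subr_ge0//; apply: le_trans (HS _ _ st) _.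
  by rewrite ler_pM2l ?expR_gt0// (le_trans (FL _ _))// ler_wpM2l// uvM'.
have -> : S t (phi 0) + sigma *: I1 + I2 - (S t (psi 0) + sigma *: J1 + J2) =
    S t (phi 0 - psi 0) + sigma *: (I1 - J1) + (I2 - J2).
  by rewrite (C0B CS) ?(ltW t0)// scalerBr opprD addrACA opprD (addrACA (S t (phi 0))).
have -> : (sigma + L) * M / mu = sigma * (M / mu) + L * M / mu by ring.
rewrite [leRHS]addrA; apply: le_trans (ler_normD _ _) _; rewrite lerD//.
apply: le_trans (ler_normD _ _) _; rewrite lerD//.
  apply: le_trans (decay _ _ (ltW t0)) _; rewrite ler_pM2l ?expR_gt0//.
  have I0 : 0 \in `[- tau, 0] by rewrite in_itv /= oppr_le0 lexx tau0.
  by rewrite -(mild_initial uP)// -(mild_initial vP)// uvM// oppr_le0.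
by rewrite normrZ ger0_norm// ler_wpM2l.
Qed.

(** * Finite-dimensional ranges *)

Section fin_spanned.
Context (R : realType) (V : normedModType R).
Local Notation CV := (cplx V).
Implicit Types (E : set CV).

(** Unlike [has_dim], this asks neither independence nor closure under sums, so that it passes to
    subsets and finite unions. *)
Definition fin_spanned E : Prop := exists d (b : 'I_d -> CV),
  forall z, E z -> exists c : 'I_d -> R[i], z = \sum_i c i *: b i.

Lemma sub_fin_spanned E1 E2 : E1 `<=` E2 -> fin_spanned E2 -> fin_spanned E1.
Proof. by move=> E12 [d [b bE]]; exists d, b => z /E12 /bE. Qed.

Lemma fin_spanned0 : fin_spanned set0.
Proof. by exists 0%N, (fun=> 0). Qed.

Lemma fin_spannedU E1 E2 : fin_spanned E1 -> fin_spanned E2 -> fin_spanned (E1 `|` E2).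
Proof.
move=> [d1 [b1 bE1]] [d2 [b2 bE2]].
exists (d1 + d2)%N, (fun i => match fintype.split i with inl j => b1 j | inr j =>
  b2 j end) => z [Ez|Ez].
  have [c ->] := bE1 z Ez.
  exists (fun i => if fintype.split i is inl j then c j else 0).
  rewrite big_split_ord /= [X in _ + X]big1 ?addr0 => [|i _].
    by apply: eq_bigr => i _; rewrite (unsplitK (inl i : 'I_d1 + 'I_d2)).
  by rewrite (unsplitK (inr i : 'I_d1 + 'I_d2)) scale0r.
have [c ->] := bE2 z Ez.
exists (fun i => if fintype.split i is inr j then c j else 0).
rewrite big_split_ord /= [X in X + _]big1 ?add0r => [|i _].
  by apply: eq_bigr => i _; rewrite (unsplitK (inr i : 'I_d1 + 'I_d2)).
by rewrite (unsplitK (inl i : 'I_d1 + 'I_d2)) scale0r.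
Qed.

Lemma fin_spanned_sums E : fin_spanned E ->
  fin_spanned [set z | exists n (y : 'I_n ->
    CV), (forall i, E (y i)) /\ z = \sum_i y i].
Proof.
move=> [d [b bE]]; exists d, b => _ [n [y [Ey ->]]].
have [c yE] := choice (fun i => bE _ (Ey i)).
exists (fun j => \sum_i c i j); under eq_bigr do rewrite yE.
by rewrite exchange_big; apply: eq_bigr => j _; rewrite scaler_suml.
Qed.

Variable A : V -> V -> Prop.

Lemma total_multiplicity_fin_spanned a k : total_multiplicity A a k ->
  fin_spanned [set z | exists2 lam, cplx_eigenvalue A lam /\ complex.Re lam = a
                                  & gen_eigenvectors A lam z].
Proof.
move=> [s [mult [_ sP dimP _]]].
apply: (@sub_fin_spanned _ [set z | exists2 lam, lam \in s & gen_eigenvectors A lam z]).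
  by move=> z [lam /sP ls lz]; exists lam.
elim: s {sP} dimP => [|lam s IH] dimP.
  by apply: sub_fin_spanned fin_spanned0 => z [].
have [b [_ bE]] : has_dim (gen_eigenvectors A lam) (mult lam) by apply: dimP;
  rewrite mem_head.
apply: (@sub_fin_spanned _ (gen_eigenvectors A lam `|`
    [set z | exists2 lam, lam \in s & gen_eigenvectors A lam z])).
  move=> z [l]; rewrite inE => /orP[/eqP -> lz|ls lz]; [by left|by right; exists l].
apply: fin_spannedU; first by exists (mult lam), b => z; rewrite bE.
by apply: IH => l ls; apply: dimP; rewrite inE ls orbT.
Qed.

Lemma gen_eigenspace_fin_spanned (rho : nat -> R) (n : nat -> nat) (m : nat) :
  (forall j, (1 <= j)%N -> total_multiplicity A (rho j) (n j)) ->
  fin_spanned (gen_eigenspace A [set lam | cplx_eigenvalue A lam /\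
               exists2 j, (1 <= j <= m)%N & complex.Re lam = rho j]).
Proof.
move=> Hm; pose E j := [set z | exists2 lam, cplx_eigenvalue A lam /\ complex.Re
  lam = rho j
                                  & gen_eigenvectors A lam z].
have : fin_spanned [set z | exists2 j, (1 <= j <= m)%N & E j z].
  elim: m => [|m IH].
    by apply: sub_fin_spanned fin_spanned0 => z [[|j]].
  apply: (@sub_fin_spanned _ ([set z | exists2 j, (1 <= j <= m)%N & E j z] `|` E m.+1)).
    move=> z [j /andP[j1]]; rewrite leq_eqVlt => /orP[/eqP -> Ez|jm Ez]; first by right.
    by left; exists j => //; rewrite j1.
  by apply: fin_spannedU => //; exact: total_multiplicity_fin_spanned (Hm _ _).
move=> /fin_spanned_sums; apply: sub_fin_spanned => z [k [lam [y [lamy ->]]]].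
exists k, y; split => // i; have [[el [j jm rl]] yl] := lamy i.
by exists j => //; exists (lam i).
Qed.

Lemma cplx_sum1 n (z : 'I_n -> CV) : (\sum_i z i).1 = \sum_i (z i).1.
Proof. by rewrite (big_morph (fun z : CV => z.1) (id1 := 0) (op1 := +%R)). Qed.

Lemma cplx_sum2 n (z : 'I_n -> CV) : (\sum_i z i).2 = \sum_i (z i).2.
Proof. by rewrite (big_morph (fun z : CV => z.2) (id1 := 0) (op1 := +%R)). Qed.

(** One vector more than the spanning family gives a complex relation. As the [x i] are real, its
    real and imaginary parts are both relations, and at least one is nontrivial. *)
Lemma fin_spanned_dependent E : fin_spanned E -> exists d, forall x : 'I_d -> V,
  (forall i, E (x i, 0)) -> exists2 a : 'I_d ->
    R, (exists i, a i != 0) & \sum_i a i *: x i = 0.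
Proof.
move=> [d [b bE]]; exists d.+1 => x Ex.
have [c xE] := choice (fun i => bE _ (Ex i)).
pose C := \matrix_(i, j) c i j.
have : kermx C != 0.
  by rewrite -mxrank_eq0 mxrank_ker subn_eq0 -ltnNge ltnS rank_leq_col.
case/rowV0Pn => v /sub_kermxP vC v0.
have E0 : \sum_i v 0 i *: ((x i, 0) : CV) = 0.
  under eq_bigr do rewrite xE scaler_sumr.
  rewrite exchange_big big1// => j _.
  under eq_bigr do rewrite scalerA.
  rewrite -scaler_suml; have /rowP/(_ j) := vC; rewrite !mxE.
  by under eq_bigr do rewrite mxE; move=> ->; rewrite scale0r.
have [i vi] : exists i, v 0 i != 0.
  apply/existsP; rewrite -negb_forall; apply: contra v0 => /forallP v0.
  by apply/eqP/rowP => i; rewrite mxE; apply/eqP.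
have [r0|r0] := eqVneq (complex.Re (v 0 i)) 0.
  exists (fun i => complex.Im (v 0 i)).
    exists i; apply: contra vi => /eqP im0.
    by apply/eqP; move: r0 im0; case: (v 0 i) => p q /= -> ->.
  have := congr1 (fun z : CV => z.2) E0; rewrite cplx_sum2 => E2.
  by apply: etrans E2; apply: eq_bigr => k _; rewrite /= scaler0 add0r.
exists (fun i => complex.Re (v 0 i)); first by exists i.
have := congr1 (fun z : CV => z.1) E0; rewrite cplx_sum1 => E1.
by apply: etrans E1; apply: eq_bigr => k _; rewrite /= scaler0 subr0.
Qed.

End fin_spanned.

(** * Delay greater than 1: histories annihilated by the spectral projection *)

Section delayed_history.
Context (R : realType) (X : normedModType R) (tau : R).
Hypothesis tau1 : 1 < tau.

(** The exponents start at 1, so that every bump vanishes up to time 1 - tau and is continuous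
    there; from then on a combination is a polynomial in t - (1 - tau) times [e]. *)
Let bump (e : X) (k : nat) (t : R) : X := (Num.max 0 (t - (1 - tau))) ^+ k.+1 *: e.

Let bump_continuous e k : continuous (bump e k).
Proof.
move=> t; apply: (@cvgZr_tmp _ _ _ _ _ (fun t => Num.max 0 (t - (1 - tau)) ^+ k.+1)).
have c : {for t, continuous (fun t : R => Num.max 0 (t - (1 - tau)))}.
  apply: (@continuous_max R R (fun=> 0) (fun t => t - (1 - tau))); first exact: cvg_cst.
  by apply: cvgB; [exact: cvg_id|exact: cvg_cst].
exact: (continuous_comp c (@exprn_continuous _ _ _)).
Qed.

Let bump_hist e k : hist X tau := hist_of_fun tau (bump_continuous (e := e) (k := k)).

Let hist_sumE n (x : 'I_n -> hist X tau) t : (\sum_i x i) t = \sum_i x i t.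
Proof. by rewrite (big_morph (fun x : hist X tau => x t) (id1 := 0) (op1 := +%R)). Qed.

Let comb_bumpE e n (a : 'I_n -> R) t : t \in `[- tau, 0] ->
  (\sum_i a i *: bump_hist e i) t =
  (Num.max 0 (t - (1 - tau)) * (\poly_(k < n) (if insub k is Some i then a i else
    0)).[Num.max 0 (t - (1 - tau))]) *: e.
Proof.
move=> tI; rewrite hist_sumE horner_poly mulr_sumr scaler_suml; apply: eq_bigr => i _.
rewrite -[LHS]/(a i *: bump_hist e i t) hist_of_funE// /bump scalerA valK exprS.
by congr (_ *: _); rewrite mulrCA.
Qed.

Lemma hist_late_combination_neq0 (e : X) n : e != 0 -> exists x : 'I_n -> hist X tau,
  forall a : 'I_n -> R, (exists i, a i != 0) ->
    \sum_i a i *: x i != 0 /\ forall t, t <= 1 - tau -> (\sum_i a i *: x i) t = 0.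
Proof.
move=> e0; exists (fun i => bump_hist e i) => a [i ai]; split; last first.
  move=> t tt; have [tI|tI] := boolP (t \in `[- tau, 0]).
    by rewrite comb_bumpE// max_l ?subr_le0// mul0r scale0r.
  by have /asboolP[_ ->] := hist_funP (\sum_i a i *: bump_hist e i).
pose p := \poly_(k < n) (if insub k is Some i then a i else 0).
have p0 : p != 0.
  by apply: contra ai => /eqP p0;
    have := coef_poly n (fun k => if insub k is Some i then a i else 0) i;
     rewrite -/p p0 coef0 ltn_ord valK => ->.
apply/negP => /eqP x0.
(* Distinct points of ]0, tau - 1]; [size p] of them are more roots than a nonzero [p] can have. *)
pose s j : R := (tau - 1) / j.+1%:R.
have s0 j : 0 < s j by rewrite divr_gt0 ?subr_gt0.
have st j : s j <= tau - 1 by rewrite ler_pdivrMr// ler_peMr ?ler1n// subr_ge0 ltW.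
have sp j : root p (s j).
  have tI : s j + (1 - tau) \in `[- tau, 0].
    rewrite in_itv /=; have := s0 j; have := st j; move: tau1; lra.
  have := congr1 (fun x : hist X tau => x (s j + (1 - tau))) x0.
  rewrite comb_bumpE// addrK max_r ?ltW// => /eqP; rewrite scaler_eq0 (negbTE e0) orbF.
  by rewrite mulf_eq0 gt_eqF.
have := @max_poly_roots _ p (mkseq s (size p)) p0.
rewrite size_mkseq ltnn => H; suff : false by []. apply: H.
  by apply/allP => _ /mapP[j _ ->].
have t0 : tau - 1 != 0 by rewrite gt_eqF ?subr_gt0.
by rewrite mkseq_uniq// => j k /(mulfI t0)/invr_inj/eqP; rewrite eqr_nat => /eqP[].
Qed.

Lemma norm_le_solution_semigroup1 (S : R -> X -> X) (sigma : R) (F : X -> X)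
    (U : R -> hist X tau -> hist X tau) (x : hist X tau) :
  solution_semigroup S sigma F U -> (forall t, t <= 1 - tau -> x t = 0) ->
    `|x| <= `|U 1 x|.
Proof.
move=> HU x0; have [u uP Uu] := HU x.
apply: hist_norm_le => [|t tI]; first exact: normr_ge0.
have [t1|t1] := leP t (1 - tau); first by rewrite x0// normr0.
have tI1 : t - 1 \in `[- tau, 0].
  by move: tI t1; rewrite !in_itv /= => /andP[? ?] ?; apply/andP; split; lra.
rewrite -(mild_initial uP tI) (_ : t = 1 + (t - 1)); last by rewrite addrC subrK.
by rewrite -Uu//; exact: hist_norm_ubound.
Qed.

Lemma spectral_projection_const_ge1 (S : R -> X -> X) (sigma : R) (F : X -> X)
    (U : R -> hist X tau -> hist X tau) (A : hist X tau -> hist X tau -> Prop)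
    (rho : nat -> R) (n : nat -> nat) (m : nat) (P : hist X tau -> hist X tau) (C : R) :
  solution_semigroup S sigma F U -> spectral_enumeration A rho n ->
  spectral_projection A
    [set lam | cplx_eigenvalue A lam /\
               exists2 j, (1 <= j <= m)%N & complex.Re lam = rho j] P ->
  (forall x, `|U 1 (x - P x)| <= C * `|x|) -> 1 <= C.
Proof.
move=> HU [_ rhoP mulP] HP HC.
(* In a trivial space there would be no eigenvalue, but the enumeration provides one with real part
   [rho 1]. *)
have [e e0] : exists e : X, e != 0.
  have [lam [z z0 _] _] : exists2 lam, cplx_eigenvalue A lam & complex.Re lam = rho 1%N.
    by apply/rhoP; exists 1%N.
  apply: contrapT => /forallNP X0.
  have H0 (y : hist X tau) : y = 0.
    apply/val_inj/funext => t; have /negP := X0 (val y t); rewrite negbK => /eqP ->.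
    by [].
  by move: z0; case: z => z1 z2; rewrite (H0 z1) (H0 z2) eqxx.
have [d Hd] := fin_spanned_dependent (gen_eigenspace_fin_spanned m mulP).
(* As many late histories as force their images under [P] to be dependent; the coefficients of that
   relation give a nonzero history in the kernel of [P]. *)
have [x Hx] := hist_late_combination_neq0 d e0.
have PE i : gen_eigenspace A [set lam | cplx_eigenvalue A lam /\
               exists2 j, (1 <= j <= m)%N & complex.Re lam = rho j] (P (x i), 0).
  have : range P (P (x i)) by exists (x i).
  by rewrite (sproj_range HP).
have [a a0 Pa] := Hd (P \o x) PE.
have [y0 yt] := Hx a a0; set y := \sum_i a i *: x i in y0 yt.
have P0 : P 0 = 0.
  by apply: (addrI (P 0)); rewrite addr0 -{1}[P 0]scale1r -(sproj_linear HP)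
    scale1r addr0.
have Psum k (a' : 'I_k -> R) (x' : 'I_k -> hist X tau) :
    P (\sum_i a' i *: x' i) = \sum_i a' i *: P (x' i).
  elim: k a' x' => [|k IH] a' x'; first by rewrite !big_ord0.
  by rewrite !big_ord_recl (sproj_linear HP) IH.
have Py : P y = 0 by rewrite /y Psum.
have := HC y; rewrite Py subr0 => /(le_trans (norm_le_solution_semigroup1 HU yt)).
by rewrite ler_pMl ?normr_gt0.
Qed.

End delayed_history.

(** * Collapse of the attractor *)

Lemma attractor_subsingleton (R : realType) (X : normedModType R) (S : R -> X -> X)
    (sigma : R) (F : X -> X) (tau mu L : R)
    (Phi : R -> hist X tau -> hist X tau) (A : set (hist X tau)) :
  C0_semigroup S -> 0 < mu -> 0 <= sigma -> 0 <= L -> 0 < tau ->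
  (forall x s, 0 <= s -> `|S s x| <= expR (- (mu * s)) * `|x|) ->
  (forall x y, `|F x - F y| <= L * `|x - y|) -> sigma + L < mu ->
  solution_semigroup S sigma F Phi -> global_attractor Phi A -> is_subset1 A.
Proof.
move=> CS mu0 sigma0 L0 tau0 decay FL sL HPhi HA.
have PhiA t x : 0 <= t -> A x -> A (Phi t x).
  by move=> t0 Ax; rewrite -(attractor_invariant HA t0); exists x.
pose D := [set r | exists x y, [/\ A x, A y & r = `|x - y|]].
have [B HB] : exists B, forall x, A x -> `|x| <= B.
  have [B [_ HB]] := compact_bounded (attractor_compact HA).
  by exists (B + 1); apply: HB; rewrite ltrDl.
have ubD : ubound D (B + B).
  by move=> _ [x [y [Ax Ay ->]]]; apply: le_trans (ler_normB _ _) _; rewrite lerD ?HB.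
(* The diameter of the attractor, to be bounded by (exp (- z) + q) M with a factor below 1. *)
pose M := sup D.
have leM x y : A x -> A y -> `|x - y| <= M.
  by move=> Ax Ay; apply: ub_le_sup; [exists (B + B)|exists x, y].
pose q := (sigma + L) / mu.
have q1 : q < 1 by rewrite ltr_pdivrMr// mul1r.
have q0 : 0 <= q by rewrite divr_ge0 ?addr_ge0// ltW.
(* Chosen so that exp (- z) <= 1 / (1 + z) <= 1 / z = (1 - q) / 2. *)
pose z := 2 / (1 - q).
have z0 : 0 < z by rewrite divr_gt0// subr_gt0.
have ez : expR (- z) <= (1 - q) / 2.
  by rewrite expRN -[leRHS]invf_div lef_pV2 ?posrE ?expR_gt0//
    (le_trans _ (expR_ge1Dx z))// lerDr.
(* The extra tau gives t + th >= z / mu for every th in [-tau, 0], so that the whole history at time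
   t is contracted. *)
pose t := tau + z / mu.
have t0 : 0 < t by rewrite addr_gt0// divr_gt0.
have contr x y : A x -> A y -> `|x - y| <= expR (- z) * M + q * M.
  move=> Ax Ay.
  have M0 : 0 <= M by apply: le_trans (leM x y Ax Ay).
  (* By invariance both points are images at time t of points whose forward trajectories stay in the
     attractor. *)
  have := Ax; rewrite -(attractor_invariant HA (ltW t0)) => -[x0 Ax0 <-].
  have := Ay; rewrite -(attractor_invariant HA (ltW t0)) => -[y0 Ay0 <-].
  have [u uP Pu] := HPhi x0; have [v vP Pv] := HPhi y0.
  have uvM s : - tau <= s -> `|u s - v s| <= M.
    move=> s0; pose r := Num.max 0 s; pose th := s - r.
    have r0 : 0 <= r by rewrite le_max lexx.
    have thI : th \in `[- tau, 0].
      rewrite in_itv /= subr_le0 [s <= _]le_max lexx orbT andbT /th /r.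
      by case: (leP 0 s) => s1; rewrite ?subrr ?subr0// oppr_le0 ltW.
    rewrite (_ : s = r + th) -?Pu -?Pv//; last by rewrite addrC subrK.
    apply: le_trans (leM _ _ (PhiA _ _ r0 Ax0) (PhiA _ _ r0 Ay0)).
    exact: (hist_norm_ubound (Phi r x0 - Phi r y0)).
  apply: hist_norm_le => [|th thI]; first by rewrite addr_ge0// mulr_ge0// expR_ge0.
  have := thI; rewrite in_itv /= => /andP[th0 th1].
  have zt : z / mu <= t + th by rewrite /t; move: th0; lra.
  rewrite -[X in `|X|]/(Phi t x0 th - Phi t y0 th) Pu ?Pv// ?(ltW t0)//.
  apply: le_trans (mild_solution_contraction CS mu0 sigma0 L0 (ltW tau0) decay FL
    uP vP uvM _) _.
    by apply: lt_le_trans zt; rewrite divr_gt0.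
  rewrite mulrAC lerD2r ler_wpM2r// ler_expR lerN2.
  by rewrite mulrC -ler_pdivrMr.
move=> x y Ax Ay; apply/eqP; rewrite -subr_eq0 -normr_le0.
apply: le_trans (leM x y Ax Ay) _.
have : M <= expR (- z) * M + q * M.
  apply: ge_sup; first by exists `|x - y|, x, y; split.
  by move=> _ [x' [y' [Ax' Ay' ->]]]; exact: contr.
rewrite -mulrDl -subr_ge0 -{2}[M]mul1r -mulrBl => H.
rewrite leNgt; apply/negP => M0; move: H; rewrite pmulr_lge0// => H.
by move: ez q1 H; lra.
Qed.

(** One ball suffices, so the logarithm of the covering number is at most 0, while - ln e > 0 for 0
    < e < 1. The empty set, covered by no balls at all, is included. *)
Lemma fractal_dim_subset1 (R : realType) (V : normedModType R) (A : set V) :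
  is_subset1 A -> (fractal_dim A <= 0)%E.
Proof.
move=> A1.
have cov e : 0 < e -> (covering_number A e <= 1)%E.
  move=> e0; apply: ereal_inf_lbound; exists 1%N => //=.
  have [->|/set0P[a Aa]] := eqVneq A set0.
    by exists (fun=> 0), (fun=> 0); split => // x [].
  exists (fun=> a), (fun=> e / 2); split => [_|x Ax];
    first by rewrite ltr_pdivrMr// ltr_pMr// ltr1n.
  by exists ord0 => //; rewrite (A1 _ _ Ax Aa); apply: ballxx; rewrite divr_gt0.
rewrite /fractal_dim limf_esupE; apply: ereal_inf_le.
exists (ereal_sup [set (lne (covering_number A e) / (- ln e)%:E)%E | e in [set e
  | 0 < e < 1]]).
  exists [set e | 0 < e < 1] => //.
  near=> e; apply/andP; split => //; near: e; exact: nbhs_right_lt.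
apply: ge_ereal_sup => _ [e /andP[e0 e1] <-].
apply: mule_le0_ge0; first by rewrite lne_le0 cov.
by rewrite inve_ge0 lee_fin oppr_ge0 ln_le0// ltW.
Unshelve. all: by end_near. Qed.

(** With a = mu - sigma - 1 the square root is exp (a tau / 2), so the condition fixes the sign of
    an exponent. Once a > 0 one has c2 >= 1, hence sigma + L^2 < a, that is mu > 2 sigma + 1 + L^2;
    this exceeds sigma + L because L <= L^2 + 1/4. *)
Lemma zeta_lt1_delay_bounds (R : realType) (mu sigma tau L : R) : 0 < sigma ->
  0 < tau ->
  let c2 := expR ((mu - sigma - 1) * tau) in
  Num.sqrt c2 * expR ((c2 * (sigma + L ^+ 2) - (mu - sigma - 1)) / 2) < 1 ->
  tau <= 1 -> sigma + L < mu.
Proof.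
move=> sigma0 tau0 /=; set a := mu - sigma - 1; set c2 := expR (a * tau).
have -> : Num.sqrt c2 = expR (a * tau / 2).
  by rewrite /c2 [a * tau]splitr expRD -expr2 sqrtr_sqr ger0_norm ?expR_ge0 // -splitr.
rewrite -expRD -[X in _ < X](@expR0 R) ltr_expR => H tau1.
have L2 : 0 < sigma + L ^+ 2 by rewrite ltr_pwDl ?sqr_ge0.
have c0 : 0 < c2 * (sigma + L ^+ 2) by rewrite mulr_gt0 ?expR_gt0.
have a0 : 0 < a.
  rewrite ltNge; apply/negP => a0;
    have : a * (1 - tau) <= 0 by rewrite mulr_le0_ge0// subr_ge0.
  by move: H c0; lra.
have c1 : 1 <= c2 by rewrite -expR0 ler_expR mulr_ge0// ltW.
have : sigma + L ^+ 2 <= c2 * (sigma + L ^+ 2) by rewrite ler_peMl// ltW.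
have : 0 < a * tau by rewrite mulr_gt0.
have : 0 <= (L - 2^-1) ^+ 2 by rewrite sqr_ge0.
rewrite sqrrB /a in H c0 a0 *; move: H sigma0; nra.
Qed.

Theorem theorem6p2 (R : realType) (N : nat) (mu sigma tau : R)
  (g : L2_Rn R N) (f : L2_Rn R N -> L2_Rn R N)
  (Lf : R)
  (* the dynamical system and its global attractor *)
  (S : R -> L2_Rn R N -> L2_Rn R N)
  (Phi : R -> hist (L2_Rn R N) tau -> hist (L2_Rn R N) tau)
  (A : set (hist (L2_Rn R N) tau))
  (* the choice of K *)
  (eps : R) (D : set (hist (L2_Rn R N) tau)) (T K : R)
  (* the delayed Dirichlet problem on the ball of radius K *)
  (SK : R -> L2_ball N K -> L2_ball N K)
  (U : R -> hist (L2_ball N K) tau -> hist (L2_ball N K) tau)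
  (rho : nat -> R) (n : nat -> nat) (m : nat)
  (P : hist (L2_ball N K) tau -> hist (L2_ball N K) tau)
  (Km beta : R) :
  (1 <= N)%N -> 0 < mu -> 0 < sigma -> 0 < tau ->
  f 0 = 0 ->
  (forall phi1 phi2 : hist (L2_Rn R N) tau,
    `|f (phi1 (- tau)) - f (phi2 (- tau))| <= Lf * `|phi1 - phi2|) ->
  sigma * (Lf + 1) * expR (mu * tau) - mu < 0 ->
  C0_generated (fun u v => dirichlet_laplacian setT u (v + mu *: u)) S ->
  solution_semigroup S sigma (fun u => f u + g) Phi ->
  global_attractor Phi A ->
  0 < eps -> bounded_set D -> 0 < T -> 0 < K ->
  (forall phi t K', D phi -> T <= t -> K <= K' ->
    (ereal_sup [set tail_mass (Phi t phi theta) K' | theta in `[(- tau)%R, 0%R]%classic]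
       <= eps%:E)%E) ->
  C0_generated
    (fun u v => dirichlet_laplacian (eball N K) u (v + mu *: u)) SK ->
  solution_semigroup SK sigma (fun=> 0) U ->
  spectral_enumeration (generator U) rho n ->
  (1 <= m)%N -> rho m < 0 ->
  spectral_projection (generator U)
    [set lam | cplx_eigenvalue (generator U) lam /\
               exists2 j, (1 <= j <= m)%N & complex.Re lam = rho j] P ->
  0 < Km ->
  (forall t x, 0 <= t -> `|U t (x - P x)| <= Km * expR (rho m * t) * `|x|) ->
  0 < beta ->
  let k := (\sum_(1 <= j < m.+1) n j)%N in
  let c2 := expR ((mu - sigma - 1) * tau) in
  let zeta := beta * expR (Lf + rho 1%N) + Km * expR (rho m)
    + Km * Lf / (rho 1%N + Lf - rho m) * expR (Lf + rho 1%N)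
    + Num.sqrt c2 * expR ((c2 * (sigma + Lf ^+ 2) - (mu - sigma - 1)) / 2) in
  zeta < 1 ->
  let bound := (ln k%:R + k%:R * ln (2 + 2 / beta)) / - ln zeta in
  (fractal_dim A <= bound%:E < +oo)%E.
Proof.
move=> _ mu0 sigma0 tau0 _ fL _ [CS genS] HPhi HA _ _ _ _ _ _
  HU Hrho m1 rm0 HP Km0 HKm beta0.
(* In [lazy zeta] the word is the reduction flag, which substitutes [bound]; it is not the
   number. *)
move=> k c2 zeta zeta1; lazy zeta.
suff A1 : is_subset1 A.
  rewrite ltry andbT (le_trans (fractal_dim_subset1 A1))// lee_fin.
  (* For k = 0 the convention that ln 0 is 0 applies. *)
  have lnk : 0 <= ln k%:R :> R.
    by have [->|k0] := posnP k; [rewrite ln0|rewrite ln_ge0// ler1n].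
  rewrite divr_ge0 ?oppr_ge0 ?ln_le0 ?(ltW zeta1)// addr_ge0// mulr_ge0// ln_ge0//.
  by have : 0 < 2 / beta; [rewrite divr_gt0|lra].
(* A negative Lipschitz constant forces all histories to coincide. *)
have [L0|L0] := ltP Lf 0.
  move=> phi psi _ _; apply/eqP; rewrite -subr_eq0 -normr_le0 -(nmulr_rge0 _ L0).
  exact: le_trans (fL phi psi).
have I0 : - tau \in `[- tau, 0] by rewrite in_itv /= lexx oppr_le0 ltW.
have fLip x y : `|f x - f y| <= Lf * `|x - y|.
  have := fL (hist_cst tau x) (hist_cst tau y);
    rewrite !hist_of_funE// => /le_trans; apply.
  rewrite ler_wpM2l//; apply: hist_norm_le => // t tI.
  by rewrite -[X in `|X|]/(hist_cst tau x t - hist_cst tau y t) !hist_of_funE.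
have rho_ge : rho m <= rho 1%N.
  have [rho_dec _ _] := Hrho; move: m1; rewrite leq_eqVlt => /orP[/eqP <-//|m1].
  by rewrite ltW// rho_dec.
have z1 : 0 < beta * expR (Lf + rho 1%N) by rewrite mulr_gt0 ?expR_gt0.
have z2 : 0 < Km * expR (rho m) by rewrite mulr_gt0 ?expR_gt0.
(* The denominator is nonnegative since rho m <= rho 1; should it be 0, the quotient is 0 by
   convention. *)
have z3 : 0 <= Km * Lf / (rho 1%N + Lf - rho m) * expR (Lf + rho 1%N).
  rewrite mulr_ge0 ?expR_ge0// divr_ge0 ?mulr_ge0// ?(ltW Km0)//.
  by move: rho_ge L0; lra.
have z4 : 0 <= Num.sqrt c2 * expR ((c2 * (sigma + Lf ^+ 2) - (mu - sigma - 1)) / 2).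
  by rewrite mulr_ge0 ?sqrtr_ge0 ?expR_ge0.
have tau1 : tau <= 1.
  rewrite leNgt; apply/negP => tau1.
  have : 1 <= Km * expR (rho m).
    apply: (spectral_projection_const_ge1 tau1 HU Hrho HP) => x.
    by have := HKm 1 x ler01; rewrite mulr1.
  by move: zeta1 z1 z3 z4; rewrite /zeta; lra.
have sL : sigma + Lf < mu.
  apply: (zeta_lt1_delay_bounds sigma0 tau0 _ tau1).
  by move: zeta1 z1 z2 z3; rewrite /zeta /c2; lra.
have decay : forall x s, 0 <= s -> `|S s x| <= expR (- (mu * s)) * `|x|.
  apply: (C0_decay (sigma := sigma) (F := fun u => f u + g) tau0 (ltW mu0) CS).
    by move=> phi; have [u uP _] := HPhi phi; exists u.
  by move=> x y h h0 /genS; apply: dirichlet_dissipative => //; exact: ltW.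
apply: (attractor_subsingleton CS mu0 (ltW sigma0) L0 tau0 decay _ sL HPhi HA) => x y.
by rewrite opprD addrACA subrr addr0.
Qed.
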